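(* Let $\mathcal A(x,q)=\sum_{n\ge 0}\mathcal A_n^{FC}(q)\,x^n$, and let $$\mathcal J(x)=\sum_{n\ge 0}\frac{(-1)^{\lceil n/2\rceil}x^n q^{\binom n2}}{(q^2;q^2)_{\lfloor n/2\rfloor}}.$$ Then $\mathcal A(x,q)=\dfrac{\mathcal J(-xq)}{\mathcal J(x)}$, and for every $n\ge 3$, $\tilde{\mathcal A}_{n-1}^{FC}(q)$ equals the coefficient of $x^n$ in $-x\,\dfrac{\mathcal J'(x)}{\mathcal J(x)}$ (derivative with respect to $x$).
   Context: For a Coxeter system $(W,S)$, $\ell(w)$ is the Coxeter length; $w$ is fully commutative (fc) if any reduced expression of $w$ can be obtained from any other using only commutation relations $st=ts$ ($m_{st}=2$). An fc involution is an fc element $w$ with $w^2=1$ (the identity included). $\mathcal W^{FC}(q)=\sum_{w} q^{\ell(w)}$ over fc involutions $w$ of $W$. $A_n$ is the Coxeter group of type $A_n$ (symmetric group on $n+1$ letters, $n$ adjacent transpositions), $A_0$ trivial. For $n\ge3$, $\tilde A_{n-1}$ is the affine Coxeter group whose Coxeter graph is an $n$-cycle. Notation: $(a;q^2)_n=(1-a)(1-aq^2)\cdots(1-aq^{2n-2})$. *)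

(* Defs.v *)
From HB Require Import structures.
From Stdlib Require Import Relation_Operators.
From mathcomp Require Import all_boot all_order all_algebra finmap.
From mathcomp Require Import boolp classical_sets cardinality.

Set Implicit Arguments.
Unset Strict Implicit.
Unset Printing Implicit Defensive.

Import GRing.Theory.

(** * Formal power series *)

Section FormalPowerSeries.
Local Open Scope ring_scope.

(* A record rather than an alias of [nat -> R], so that the Cauchy product
   below does not clash with the pointwise ring structure on functions. *)
Record fps (R : Type) := Fps { fps_coef : nat -> R }.

HB.instance Definition _ (R : Type) := gen_eqMixin (fps R).
HB.instance Definition _ (R : Type) := gen_choiceMixin (fps R).

Lemma fpsP (R : Type) (f g : fps R) :
  (forall n, fps_coef f n = fps_coef g n) <-> f = g.
Proof.
split=> [|-> //]; case: f g => [f] [g] /= fg.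
by congr Fps; apply/funext.
Qed.

Section Zmodule.
Variable R : zmodType.

Definition fps_zero : fps R := Fps (fun=> 0).
Definition fps_opp (f : fps R) : fps R := Fps (fun n => - fps_coef f n).
Definition fps_add (f g : fps R) : fps R :=
  Fps (fun n => fps_coef f n + fps_coef g n).

Fact fps_addA : associative fps_add.
Proof. by move=> f g h; apply/fpsP=> n /=; rewrite addrA. Qed.
Fact fps_addC : commutative fps_add.
Proof. by move=> f g; apply/fpsP=> n /=; rewrite addrC. Qed.
Fact fps_add0 : left_id fps_zero fps_add.
Proof. by move=> f; apply/fpsP=> n /=; rewrite add0r. Qed.
Fact fps_addN : left_inverse fps_zero fps_opp fps_add.
Proof. by move=> f; apply/fpsP=> n /=; rewrite addNr. Qed.

HB.instance Definition _ :=
  GRing.isZmodule.Build (fps R) fps_addA fps_addC fps_add0 fps_addN.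

End Zmodule.

Section Ring.
Variable R : comNzRingType.

Definition fps_one : fps R := Fps (fun n => (n == 0%N)%:R).
Definition fps_mul (f g : fps R) : fps R :=
  Fps (fun n => \sum_(i < n.+1) fps_coef f i * fps_coef g (n - i)).

Let trunc N (f : fps R) : {poly R} := \poly_(i < N) fps_coef f i.

Let fps_mul_trunc N f g n : (n < N)%N ->
  fps_coef (fps_mul f g) n = (trunc N f * trunc N g)`_n.
Proof.
move=> nN; rewrite coefM /=; apply: eq_bigr => i _; rewrite !coef_poly.
have iN : (i < N)%N by apply: leq_trans nN; apply: ltn_ord.
by rewrite iN (leq_ltn_trans (leq_subr _ _) nN).
Qed.

Let coefM_low (p p' r r' : {poly R}) n :
  (forall i, (i <= n)%N -> p`_i = p'`_i) ->
  (forall i, (i <= n)%N -> r`_i = r'`_i) -> (p * r)`_n = (p' * r')`_n.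
Proof.
move=> pp' rr'; rewrite !coefM; apply: eq_bigr => i _.
by rewrite pp' ?rr' ?leq_subr // -ltnS.
Qed.

Let coef_trunc N f i : (i < N)%N -> (trunc N f)`_i = fps_coef f i.
Proof. by move=> iN; rewrite coef_poly iN. Qed.

Fact fps_mulA : associative fps_mul.
Proof.
move=> f g h; apply/fpsP=> n; rewrite !(@fps_mul_trunc n.+1) //.
transitivity ((trunc n.+1 f * (trunc n.+1 g * trunc n.+1 h))`_n).
  apply: coefM_low => // i le_in.
  by rewrite coef_trunc ?ltnS // (@fps_mul_trunc n.+1).
rewrite mulrA; apply: coefM_low => // i le_in.
by rewrite coef_trunc ?ltnS // (@fps_mul_trunc n.+1).
Qed.

Fact fps_mulC : commutative fps_mul.
Proof.
by move=> f g; apply/fpsP=> n; rewrite !(@fps_mul_trunc n.+1) // mulrC.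
Qed.

Fact fps_mul1 : left_id fps_one fps_mul.
Proof.
move=> f; apply/fpsP=> n /=; rewrite big_ord_recl /= subn0 mul1r.
by rewrite big1 ?addr0 // => i _; rewrite mul0r.
Qed.

Fact fps_mulDl : left_distributive fps_mul +%R.
Proof.
move=> f g h; apply/fpsP=> n /=; rewrite -big_split /=.
by apply: eq_bigr => i _; rewrite mulrDl.
Qed.

Fact fps_one_neq0 : fps_one != 0.
Proof. by apply/eqP => /fpsP /(_ 0%N) /eqP; rewrite /= oner_eq0. Qed.

HB.instance Definition _ := GRing.Zmodule_isComNzRing.Build (fps R)
  fps_mulA fps_mulC fps_mul1 fps_mulDl fps_one_neq0.

Lemma fps_coefM (f g : fps R) n :
  fps_coef (f * g) n = \sum_(i < n.+1) fps_coef f i * fps_coef g (n - i).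
Proof. by []. Qed.

Lemma fps_coef1 n : fps_coef (1 : fps R) n = (n == 0%N)%:R.
Proof. by []. Qed.

Definition fpsX : fps R := Fps (fun n => (n == 1%N)%:R).

Definition fps_deriv (f : fps R) : fps R :=
  Fps (fun n => fps_coef f n.+1 *+ n.+1).

(* The substitution f(c x). *)
Definition fps_scale (c : R) (f : fps R) : fps R :=
  Fps (fun n => c ^+ n * fps_coef f n).

End Ring.

Section UnitRing.
Variable R : comUnitRingType.

Definition fps_unit : {pred fps R} :=
  fun f => fps_coef f 0 \is a GRing.unit.

(* The first n coefficients g_0, ..., g_(n-1) of 1/f, from
   f_0 g_n = [n = 0] - \sum_(i < n) f_(n-i) g_i. *)
Fixpoint fps_inv_seq (f : fps R) (n : nat) : seq R :=
  if n is n'.+1 then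
    let s := fps_inv_seq f n' in
    rcons s ((fps_coef f 0)^-1 *
             ((n' == 0%N)%:R - \sum_(i < n') fps_coef f (n' - i) * s`_i))
  else [::].

Definition fps_inv (f : fps R) : fps R :=
  if f \in fps_unit then Fps (fun n => (fps_inv_seq f n.+1)`_n) else f.

Let size_inv_seq f n : size (fps_inv_seq f n) = n.
Proof. by elim: n => //= n IHn; rewrite size_rcons IHn. Qed.

Let nth_inv_seq f n i : (i < n)%N ->
  (fps_inv_seq f n)`_i = (fps_inv_seq f i.+1)`_i.
Proof.
elim: n => // n IHn; rewrite ltnS leq_eqVlt => /predU1P[-> //|lt_in].
by rewrite {1}[fps_inv_seq f n.+1]/= nth_rcons size_inv_seq lt_in IHn.
Qed.

Fact fps_mulV : {in fps_unit, left_inverse 1 fps_inv *%R}.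
Proof.
move=> f Uf; rewrite mulrC; apply/fpsP=> n; rewrite fps_coefM fps_coef1.
rewrite /fps_inv Uf big_ord_recl subn0 /= nth_rcons size_inv_seq ltnn eqxx.
rewrite mulrA divrr // mul1r -[RHS]addr0 -addrA; congr (_ + _).
apply/eqP; rewrite addrC subr_eq0; apply/eqP.
rewrite [RHS](reindex_inj rev_ord_inj) /=; apply: eq_bigr => i _.
have lt_n := ltn_ord i; rewrite subKn //; congr (_ * _).
rewrite [RHS]nth_inv_seq //=; last by rewrite ltn_subrL (leq_ltn_trans _ lt_n).
Qed.

Fact fps_unitPl (f g : fps R) : g * f = 1 -> f \in fps_unit.
Proof.
move/fpsP/(_ 0%N); rewrite fps_coefM fps_coef1 big_ord1 /= => gf1.
by apply/unitrPr; exists (fps_coef g 0); rewrite mulrC.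
Qed.

Fact fps_inv_out : {in [predC fps_unit], fps_inv =1 id}.
Proof. by move=> f; rewrite inE /= /fps_inv => /negbTE ->. Qed.

HB.instance Definition _ := GRing.ComNzRing_hasMulInverse.Build (fps R)
  fps_mulV fps_unitPl fps_inv_out.

Lemma fps_unitE (f : fps R) :
  (f \is a GRing.unit) = (fps_coef f 0 \is a GRing.unit).
Proof. by []. Qed.

End UnitRing.

End FormalPowerSeries.

Arguments fpsX {R}.

(** * Coxeter systems and fully commutative involutions *)

(* The value 0 encodes m_st = oo: the relation (st)^0 = 1 is void. *)
Record coxeter_matrix (S : Type) := CoxeterMatrix {
  cox_m :> S -> S -> nat;
  cox_m_sym : forall s t, cox_m s t = cox_m t s;
  cox_m_diag : forall s t, cox_m s t = 1%N <-> s = t }.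

Section CoxeterGroup.
Variables (S : finType) (m : coxeter_matrix S).

Inductive cox_step : seq S -> seq S -> Prop :=
| CoxStep u v s t :
    cox_step (u ++ flatten (nseq (m s t) [:: s; t]) ++ v) (u ++ v).

(* The generators are involutions (m_ss = 1), so the monoid presented by the
   relations (st)^(m_st) = 1 is the group with the same presentation. *)
Definition cox_equiv (u v : seq S) : bool :=
  `[< clos_refl_sym_trans _ cox_step u v >].

Fact cox_equiv_refl : reflexive cox_equiv.
Proof. by move=> u; apply/asboolP; apply: rst_refl. Qed.
Fact cox_equiv_sym : symmetric cox_equiv.
Proof.
by move=> u v; apply/asboolP/asboolP => uv; apply: rst_sym.
Qed.
Fact cox_equiv_trans : transitive cox_equiv.
Proof.
by move=> v u w /asboolP uv /asboolP vw; apply/asboolP; apply: rst_trans vw.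
Qed.

Canonical cox_equiv_rel :=
  EquivRel cox_equiv cox_equiv_refl cox_equiv_sym cox_equiv_trans.

Definition coxeter_group := {eq_quot cox_equiv_rel}%qT.
HB.instance Definition _ := Choice.on coxeter_group.

Definition cox_pi (u : seq S) : coxeter_group := (\pi u)%qT.

Lemma cox_piP u v : reflect (cox_pi u = cox_pi v) (cox_equiv u v).
Proof. exact: (@eqmodP _ cox_equiv_rel). Qed.

Lemma cox_reprK (w : coxeter_group) : cox_pi (repr w) = w.
Proof. exact: reprK. Qed.

Definition cox_one : coxeter_group := cox_pi [::].
Definition cox_mul (w w' : coxeter_group) : coxeter_group :=
  cox_pi (repr w ++ repr w').
Definition cox_inv (w : coxeter_group) : coxeter_group :=
  cox_pi (rev (repr w)).

Let cat_equiv_l x u v : cox_equiv u v -> cox_equiv (x ++ u) (x ++ v).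
Proof.
move=> /asboolP uv; apply/asboolP; elim: uv => {u v}.
- by move=> _ _ [u v s t]; rewrite !catA -(catA (x ++ u)); apply/rst_step.
- by move=> u; apply: rst_refl.
- by move=> u v _; apply: rst_sym.
- by move=> u v w _ uv _; apply: rst_trans uv.
Qed.

Let cat_equiv_r x u v : cox_equiv u v -> cox_equiv (u ++ x) (v ++ x).
Proof.
move=> /asboolP uv; apply/asboolP; elim: uv => {u v}.
- by move=> _ _ [u v s t]; rewrite -!catA; apply/rst_step.
- by move=> u; apply: rst_refl.
- by move=> u v _; apply: rst_sym.
- by move=> u v w _ uv _; apply: rst_trans uv.
Qed.

Let rev_equiv u v : cox_equiv u v -> cox_equiv (rev u) (rev v).
Proof.
move=> /asboolP uv; apply/asboolP; elim: uv => {u v}.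
- move=> _ _ [u v s t]; rewrite !rev_cat -catA.
  suff -> : rev (flatten (nseq (m s t) [:: s; t])) =
            flatten (nseq (m t s) [:: t; s]) by apply: rst_step.
  rewrite cox_m_sym; elim: (m t s) => //= k IHk.
  rewrite -[s :: t :: _]/([:: s; t] ++ _) rev_cat IHk.
  by elim: k {IHk} => //= k ->.
- by move=> u; apply: rst_refl.
- by move=> u v _; apply: rst_sym.
- by move=> u v w _ uv _; apply: rst_trans uv.
Qed.

Lemma cox_pi_cat u v : cox_pi (u ++ v) = cox_mul (cox_pi u) (cox_pi v).
Proof.
have /cox_piP eq_u := cox_reprK (cox_pi u).
have /cox_piP eq_v := cox_reprK (cox_pi v).
apply/esym/cox_piP; apply: (@cox_equiv_trans (u ++ repr (cox_pi v))).
  exact: cat_equiv_r.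
exact: cat_equiv_l.
Qed.

Let cox_inv_pi u : cox_inv (cox_pi u) = cox_pi (rev u).
Proof. by apply/cox_piP/rev_equiv/cox_piP/cox_reprK. Qed.

Fact cox_mulA : associative cox_mul.
Proof.
move=> w1 w2 w3; rewrite -(cox_reprK w1) -(cox_reprK w2) -(cox_reprK w3).
by rewrite -!cox_pi_cat catA.
Qed.

Fact cox_mul1 : left_id cox_one cox_mul.
Proof. by move=> w; rewrite -(cox_reprK w) -cox_pi_cat. Qed.

Fact cox_mulg1 : right_id cox_one cox_mul.
Proof. by move=> w; rewrite -(cox_reprK w) -cox_pi_cat cats0. Qed.

Let rev_cat_equiv u : cox_equiv (rev u ++ u) [::].
Proof.
elim: u => [|s u IHu]; first exact: cox_equiv_refl.
rewrite rev_cons cat_rcons; apply: cox_equiv_trans IHu.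
apply/asboolP; apply: rst_step.
have {1}-> : [:: s, s & u] = flatten (nseq (m s s) [:: s; s]) ++ u.
  by rewrite (proj2 (cox_m_diag m s s)).
exact: CoxStep.
Qed.

Fact cox_mulV : left_inverse cox_one cox_inv cox_mul.
Proof.
move=> w; rewrite -(cox_reprK w) cox_inv_pi -cox_pi_cat.
exact/cox_piP/rev_cat_equiv.
Qed.

Fact cox_mulgV : right_inverse cox_one cox_inv cox_mul.
Proof.
move=> w; rewrite -(cox_reprK w) cox_inv_pi -cox_pi_cat.
by apply/cox_piP; rewrite -{1}[repr w]revK; apply: rev_cat_equiv.
Qed.

HB.instance Definition _ := isGroup.Build coxeter_group
  cox_mulA cox_mul1 cox_mulg1 cox_mulV cox_mulgV.

Definition cox_gen (s : S) : coxeter_group := cox_pi [:: s].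

Local Open Scope group_scope.

Definition cox_word (u : seq S) : coxeter_group := \prod_(s <- u) cox_gen s.

Lemma cox_wordE u : cox_word u = cox_pi u.
Proof.
rewrite /cox_word; elim: u => [|s u IHu]; first by rewrite big_nil.
by rewrite big_cons IHu -[s :: u]/([:: s] ++ u) cox_pi_cat.
Qed.

Fact cox_length_subproof (w : coxeter_group) :
  exists k, `[< exists2 u, size u = k & cox_word u = w >].
Proof.
exists (size (repr w)); apply/asboolP; exists (repr w) => //.
by rewrite cox_wordE cox_reprK.
Qed.

Definition cox_length (w : coxeter_group) : nat :=
  ex_minn (cox_length_subproof w).

Definition reduced_expr (w : coxeter_group) (u : seq S) : Prop :=
  cox_word u = w /\ size u = cox_length w.

Inductive comm_step : seq S -> seq S -> Prop :=
| CommStep u v s t :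
    m s t = 2%N -> comm_step (u ++ [:: s; t] ++ v) (u ++ [:: t; s] ++ v).

Definition fully_commutative (w : coxeter_group) : Prop :=
  forall u v, reduced_expr w u -> reduced_expr w v ->
  clos_refl_trans _ comm_step u v.

Definition fc_involution (w : coxeter_group) : Prop :=
  fully_commutative w /\ w ^+ 2 = 1.

Definition fc_involutions_of_length (k : nat) : set coxeter_group :=
  [set w | fc_involution w /\ cox_length w = k]%classic.

(* [fset_set] is only meaningful on finite sets. *)
Lemma fc_involutions_of_length_finite k :
  finite_set (fc_involutions_of_length k).
Proof.
apply: (@sub_finite_set _ _
  [set` [fset cox_word (tval u) | u in {: k.-tuple S}]%fset]%classic);
  last exact: finite_fset.
move=> w [_ lw]; rewrite /=; move: lw; rewrite /cox_length.
case: ex_minnP => _ /asboolP[u <- uw] _ uk; apply/imfsetP => /=.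
have /eqP ku : size u = k by [].
by exists (Tuple ku).
Qed.

Definition fc_series : fps int :=
  Fps (fun k => Posz #|` fset_set (fc_involutions_of_length k)|%fset).

End CoxeterGroup.

Section SimplyLaced.
Variables (S : eqType) (e : rel S).
Hypothesis e_sym : symmetric e.

Definition simply_laced_m (s t : S) : nat :=
  if s == t then 1 else if e s t then 3 else 2.

Fact simply_laced_sym s t : simply_laced_m s t = simply_laced_m t s.
Proof. by rewrite /simply_laced_m eq_sym e_sym. Qed.

Fact simply_laced_diag s t : simply_laced_m s t = 1%N <-> s = t.
Proof.
by rewrite /simply_laced_m; case: eqVneq => [//|/eqP ?]; case: (e s t).
Qed.

Definition simply_laced : coxeter_matrix S :=
  CoxeterMatrix simply_laced_sym simply_laced_diag.

End SimplyLaced.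

Definition path_adj (n : nat) : rel 'I_n :=
  fun i j => (i.+1 == j) || (j.+1 == i).

Definition cycle_adj (n : nat) : rel 'I_n :=
  fun i j => (i.+1 == j %[mod n]) || (j.+1 == i %[mod n]).

Fact path_adj_sym n : symmetric (@path_adj n).
Proof. by move=> i j; rewrite /path_adj orbC. Qed.

Fact cycle_adj_sym n : symmetric (@cycle_adj n).
Proof. by move=> i j; rewrite /cycle_adj orbC. Qed.

Definition coxA (n : nat) : coxeter_matrix 'I_n := simply_laced (@path_adj_sym n).

(* Indexed by the number of vertices of the cycle: for n >= 3,
   [cox_affA n] is the affine type A~_(n-1). *)
Definition cox_affA (n : nat) : coxeter_matrix 'I_n :=
  simply_laced (@cycle_adj_sym n).

(** * The generating functions, in Z[[q]][[x]] *)

Section GeneratingFunctions.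
Local Open Scope ring_scope.

Definition q : fps int := fpsX.

(* (a; q^2)_n *)
Definition qpoch2 (a : fps int) (n : nat) : fps int :=
  \prod_(i < n) (1 - a * q ^+ (2 * i)).

Definition J : fps (fps int) :=
  Fps (fun n => (-1) ^+ uphalf n * q ^+ 'C(n, 2) / qpoch2 (q ^+ 2) n./2).

Definition A_series : fps (fps int) := Fps (fun n => fc_series (coxA n)).

(* Division by these series is genuine: in a [unitRingType] the inverse of a
   non-unit is a junk value. *)
Lemma qpoch2_unit n : qpoch2 (q ^+ 2) n \is a GRing.unit.
Proof.
apply: rpred_prod => i _; rewrite fps_unitE.
have -> : fps_coef (1 - q ^+ 2 * q ^+ (2 * i)) 0 = 1; last exact: unitr1.
rewrite -exprD addSn exprS; set f := q ^+ _.
suff qf0 : fps_coef (q * f) 0 = 0.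
  by rewrite -[LHS]/(1 - fps_coef (q * f) 0) qf0 subr0.
by rewrite fps_coefM big_ord1 mul0r.
Qed.

Lemma J_unit : J \is a GRing.unit.
Proof.
rewrite fps_unitE /= /qpoch2 big_ord0 bin_small // !expr0 mulr1.
by rewrite divr1 unitr1.
Qed.

End GeneratingFunctions.

(* Main.v *)
(** A reduced word is fully commutative exactly when no word of its commutation
class contains a factor ss or sts; this follows from the exchange property,
itself proved with the parity of the number of times a reflection occurs in a
word.  Over a graph of maximal degree 2 these words are the ones whose
projections onto the edges alternate, and such a word is commutation equivalent
to its reversal exactly when its letter counts h satisfy |h s - h t| = 1 or
h s = h t = 0 on every edge; moreover h determines the class.  So fully
commutative involutions of type A_n (resp. affine type A_(n-1)) are walks of
length n + 1 from 0 to 0 (resp. closed walks of length n) on the half-line with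
a loop at 0, the length being the sum of the heights.

With D = diag(1, q, q^2, ...) and T the adjacency matrix of that graph,
J(x) = det(1 - x D T) is a signed sum over matchings of the half-line.  Entries
of (1 - x D T)^(-1) are products of two such sums divided by J, which gives
A(x, q), and the trace formula -x J'/J = sum_n tr((D T)^n) x^n is obtained by
counting, for every vertex, the matchings that leave it uncovered. *)

Require Import Defs.
From Stdlib Require Import Relation_Operators.
From mathcomp Require Import all_boot all_order all_algebra finmap.
From mathcomp Require Import boolp classical_sets cardinality.
From mathcomp Require Import zify ring.

Set Implicit Arguments.
Unset Strict Implicit.
Unset Printing Implicit Defensive.

Import GRing.Theory.

(** * The exchange property *)

Section Exchange.
Variables (S : finType) (m : coxeter_matrix S).
Local Open Scope group_scope.
Local Notation W := (coxeter_group m).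
Local Notation pi := (@cox_pi S m).
Local Notation gen := (@cox_gen S m).

Lemma pi_cat u v : pi (u ++ v) = pi u * pi v.
Proof. exact: cox_pi_cat. Qed.

Lemma pi_nil : pi [::] = 1.
Proof. by []. Qed.

Lemma pi_cons s u : pi (s :: u) = gen s * pi u.
Proof. exact: (pi_cat [:: s]). Qed.

Lemma pi_relation u s t v :
  pi (u ++ flatten (nseq (m s t) [:: s; t]) ++ v) = pi (u ++ v).
Proof. by apply/cox_piP/asboolP/rst_step; constructor. Qed.

Lemma pi_flatten_nseq k s t :
  pi (flatten (nseq k [:: s; t])) = (gen s * gen t) ^+ k.
Proof.
elim: k => [|k IHk]; first by rewrite expg0 pi_nil.
by rewrite expgS /= !pi_cons IHk mulgA.
Qed.

Lemma gen_order s t : (gen s * gen t) ^+ m s t = 1.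
Proof.
by have := pi_relation [::] s t [::]; rewrite /= cats0 pi_flatten_nseq pi_nil.
Qed.

Lemma gen_sq s : gen s * gen s = 1.
Proof.
have := gen_order s s; have -> : m s s = 1%N by apply/cox_m_diag.
by rewrite expg1.
Qed.

Lemma genV s : (gen s)^-1 = gen s.
Proof. by rewrite -[LHS]mulg1 -(gen_sq s) mulgA mulVg mul1g. Qed.

Lemma genK s : involutive ( *%g (gen s)).
Proof. by move=> w; rewrite mulgA gen_sq mul1g. Qed.

Lemma gen_mull s (x y : W) : gen s * x = y -> x = gen s * y.
Proof. by move=> <-; rewrite genK. Qed.

Lemma pi_rev u : pi (rev u) = (pi u)^-1.
Proof.
elim: u => [|s u IHu]; first by rewrite pi_nil invg1.
by rewrite rev_cons -cats1 pi_cat IHu !pi_cons invgM genV mulg1.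
Qed.

(** Relators have even length, so the parity of the length is a character of the group. *)
Lemma odd_size_pi u v : pi u = pi v -> odd (size u) = odd (size v).
Proof.
move=> /cox_piP/asboolP; elim=> {u v}.
- move=> _ _ [u v s t]; rewrite !size_cat !oddD.
  suff -> : odd (size (flatten (nseq (m s t) [:: s; t]))) = false by [].
  by elim: (m s t) => //= k ->.
- by [].
- by move=> u v _ ->.
- by move=> u v w _ -> _ ->.
Qed.

(* For u = s_1 ... s_k, the parity of the number of i such that
   s_1 ... s_(i-1) s_i s_(i-1) ... s_1 = t. *)
Fixpoint refl_parity (u : seq S) (t : W) : bool :=
  if u is s :: u' then
    (t == gen s) (+) refl_parity u' (gen s * t * gen s)
  else false.

Lemma refl_parity_cat u v t :
  refl_parity (u ++ v) t =
  refl_parity u t (+) refl_parity v ((pi u)^-1 * t * pi u).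
Proof.
elim: u t => [|s u IHu] t /=; first by rewrite pi_nil invg1 mul1g mulg1.
by rewrite IHu addbA pi_cons invgM genV !mulgA.
Qed.

Lemma refl_parity_dihedral k s t x :
  refl_parity (flatten (nseq k [:: s; t])) x =
  \big[addb/false]_(i < k.*2) (x == (gen s * gen t) ^+ i * gen s).
Proof.
elim: k x => [|k IHk] x; first by rewrite big_ord0.
rewrite doubleS !big_ord_recl /= IHk expg0 mul1g.
congr (_ (+) (_ (+) _)).
  apply/eqP/eqP => [<-|->].
    by rewrite expg1 !mulgA gen_sq mul1g -mulgA gen_sq mulg1.
  by rewrite expg1 !mulgA gen_sq mul1g -mulgA gen_sq mulg1.
apply: eq_bigr => i _; rewrite /bump /= !add1n.
apply/eqP/eqP => [e|->]; last first.
  by rewrite expgS expgSr -!mulgA !genK gen_sq mulg1.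
have -> : x = gen s * gen t * (gen t * (gen s * x * gen s) * gen t) *
               gen t * gen s.
  by rewrite -!mulgA !(genK, gen_sq, mulg1).
by rewrite e [in RHS]expgS expgSr -!mulgA.
Qed.

(** Since [(st)^(m s t) = 1], the reflections [(st)^i s] met along the relator run twice through the
    same list, and every count is even. *)
Lemma refl_parity_relation s t x :
  refl_parity (flatten (nseq (m s t) [:: s; t])) x = false.
Proof.
rewrite refl_parity_dihedral -addnn big_split_ord /=.
under [X in _ (+) X]eq_bigr => i _ do rewrite expgnDr gen_order mul1g.
by rewrite addbb.
Qed.

Lemma refl_parity_pi u v : pi u = pi v -> refl_parity u =1 refl_parity v.
Proof.
move=> /cox_piP/asboolP; elim=> {u v}.
- move=> _ _ [u v s t] x; rewrite !refl_parity_cat refl_parity_relation.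
  by rewrite pi_flatten_nseq gen_order invg1 mulg1 mul1g.
- by [].
- by move=> u v _ + x => ->.
- by move=> u v w _ + _ + x => -> ->.
Qed.

(** An odd count is nonzero, so [t = s_1 ... s_i ... s_1] for some position i, and left
    multiplication by such a [t] deletes the letter [s_i]. *)
Lemma refl_parity_delete u t : refl_parity u t ->
  exists x s y, u = x ++ s :: y /\ t * pi u = pi (x ++ y).
Proof.
elim: u t => [|s u IHu] t //=; case: eqP => [-> _|_ /IHu].
  by exists [::], s, u; rewrite pi_cons genK.
move=> [x [a [y [-> e]]]]; exists (s :: x), a, y; split=> //=.
rewrite [pi (s :: x ++ y)]pi_cons -e pi_cons.
by rewrite -!mulgA !genK.
Qed.

Definition reduced (u : seq S) := forall v, pi v = pi u -> (size u <= size v)%N.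

Lemma reduced_exprP w u : reduced_expr w u <-> pi u = w /\ reduced u.
Proof.
rewrite /reduced_expr cox_wordE /cox_length; split.
  case=> e; case: ex_minnP => k /asboolP[v sv ev] kmin su; split=> // v' e'.
  rewrite su; apply: kmin; apply/asboolP; exists v' => //.
  by rewrite cox_wordE e' e.
case=> e ru; split=> //; case: ex_minnP => k /asboolP[v sv ev] kmin.
apply/eqP; rewrite eqn_leq; apply/andP; split.
  by rewrite -sv; apply: ru; rewrite e -ev cox_wordE.
by apply: kmin; apply/asboolP; exists u => //; rewrite cox_wordE.
Qed.

Lemma reduced_exists w : exists2 u, pi u = w & reduced u.
Proof.
have [u su eu] : exists2 u, size u = cox_length w & cox_word m u = w.
  by rewrite /cox_length; case: ex_minnP => k /asboolP[u]; exists u.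
have /reduced_exprP[??] : reduced_expr w u by [].
by exists u.
Qed.

Lemma reduced_behead s u : reduced (s :: u) -> reduced u.
Proof.
by move=> ru v e; have := ru (s :: v); rewrite !pi_cons e => /(_ erefl).
Qed.

Lemma reduced_same u v : reduced u -> pi v = pi u -> size v = size u ->
  reduced v.
Proof. by move=> ru e sz v'; rewrite e sz; apply: ru. Qed.

Lemma reduced_size u v : reduced u -> reduced v -> pi u = pi v ->
  size u = size v.
Proof.
by move=> ru rv e; apply/eqP; rewrite eqn_leq ru ?rv.
Qed.

(** In the reduced word [s :: v] the reflection [gen s] has odd parity: it is met at the first
    letter, and an odd parity in [v] would allow a deletion giving a shorter word. The parity
    depends only on the group element, so a letter of [u] can be deleted. *)
Lemma exchange s v u : reduced (s :: v) -> pi (s :: v) = pi u ->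
  exists x a y, u = x ++ a :: y /\ gen s * pi u = pi (x ++ y).
Proof.
move=> rv e; apply: refl_parity_delete; rewrite -(refl_parity_pi e) /= eqxx.
apply/negP => /refl_parity_delete[x [a [y [ev]]]].
rewrite gen_sq mul1g -pi_cons => /esym/rv.
by rewrite ev /= !size_cat /=; lia.
Qed.

End Exchange.

Lemma split_first (T : eqType) (x : T) s :
  x \in s -> exists s1 s2, s = s1 ++ x :: s2 /\ x \notin s1.
Proof.
move=> xs; exists (take (index x s) s), (drop (index x s).+1 s); split.
  by rewrite -{2}(nth_index x xs) -drop_nth ?index_mem // cat_take_drop.
by rewrite in_take_leq ?index_size // ltnn.
Qed.

(** * Fully commutative words in simply laced groups *)

Section SimplyLacedWords.
Variables (S : finType) (e : rel S) (e_sym : symmetric e).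
Hypothesis e_irr : irreflexive e.
Local Open Scope group_scope.
Local Notation m := (simply_laced e_sym).
Local Notation W := (coxeter_group m).
Local Notation pi := (@cox_pi S m).
Local Notation gen := (@cox_gen S m).

Lemma m_edge s t : e s t -> m s t = 3%N.
Proof.
by move=> st; rewrite /= /simply_laced_m st; case: eqP st => // ->; rewrite e_irr.
Qed.

Lemma m_commute s t : (m s t == 2%N) = (s != t) && ~~ e s t.
Proof. by rewrite /= /simply_laced_m; have [->|st] := eqVneq s t; case: (e _ t). Qed.

(** * Separation of the generators by the dual geometric representation *)

Section DualReflection.
Local Open Scope ring_scope.

Definition cartan (s t : S) : int :=
  if s == t then 2 else if e s t then -1 else 0.

(* The contragredient of the geometric representation: f(t) is the value of f
   on the simple root t. *)
Definition dual_refl (s : S) (f : S -> int) : S -> int :=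
  fun t => f t - cartan s t * f s.

Lemma cartan_diag s : cartan s s = 2.
Proof. by rewrite /cartan eqxx. Qed.

Lemma dual_refl_relation s t f :
  foldr dual_refl f (flatten (nseq (m s t) [:: s; t])) = f.
Proof.
apply/funext => x; rewrite /= /simply_laced_m.
case: eqVneq => [<-|st] /=.
  by rewrite /dual_refl cartan_diag; ring.
have cst : cartan s t = if e s t then -1 else 0.
  by rewrite /cartan (negbTE st).
have cts : cartan t s = if e s t then -1 else 0.
  by rewrite /cartan eq_sym (negbTE st) e_sym.
by case: (e s t) cst cts => cst cts /=;
  rewrite /dual_refl !cartan_diag cst cts; ring.
Qed.

Lemma foldr_dual_refl_pi u v f :
  pi u = pi v -> foldr dual_refl f u = foldr dual_refl f v.
Proof.
move=> /cox_piP/asboolP; elim=> {u v}.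
- by move=> _ _ [u v s t]; rewrite !foldr_cat dual_refl_relation.
- by [].
- by move=> u v _ ->.
- by move=> u v w _ -> _ ->.
Qed.

(** Acting on the indicator function of [s], the generator [s] produces the value -1 at [s], and any
    other generator the value 1. *)
Lemma gen_inj : injective gen.
Proof.
move=> s t est; apply/eqP; apply: contraT => st.
have /(congr1 (@^~ s)) := foldr_dual_refl_pi (fun x => (x == s)%:R) est.
rewrite /= /dual_refl cartan_diag eqxx [t == s]eq_sym (negbTE st).
by rewrite mulr0.
Qed.

End DualReflection.

Lemma gen_comm s t : m s t = 2%N -> gen s * gen t = gen t * gen s.
Proof.
move=> m2; have := gen_order m s t; rewrite m2 expgS expg1 -mulgA.
by move/gen_mull/gen_mull; rewrite mulg1 => e1; rewrite e1.
Qed.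

Lemma gen_braid s t : m s t = 3%N ->
  gen s * (gen t * gen s) = gen t * (gen s * gen t).
Proof.
move=> m3; have := gen_order m s t; rewrite m3 !expgS expg0 mulg1 -!mulgA.
by do 3 move/gen_mull; rewrite mulg1 => ->.
Qed.

(** * Commutation classes of words *)

Definition comm (u v : seq S) := clos_refl_trans _ (comm_step m) u v.

Lemma comm_refl u : comm u u.
Proof. exact: rt_refl. Qed.

Lemma comm_trans v u w : comm u v -> comm v w -> comm u w.
Proof. exact: rt_trans. Qed.

Lemma comm_swap s t v : m s t = 2%N -> comm [:: s, t & v] [:: t, s & v].
Proof. by move=> m2; apply: rt_step; apply: (CommStep [::] v m2). Qed.

Lemma comm_sym u v : comm u v -> comm v u.
Proof.
elim=> {u v} [_ _ [x y s t m2]|u|u v w _ vu _ wv].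
- by apply: rt_step; constructor; rewrite cox_m_sym.
- exact: comm_refl.
- exact: comm_trans vu.
Qed.

Lemma comm_cat x u v : comm u v -> comm (x ++ u) (x ++ v).
Proof.
elim=> {u v} [_ _ [x' y s t m2]|u|u v w _ uv _ vw].
- by apply: rt_step; rewrite !(catA x); apply: CommStep.
- exact: comm_refl.
- exact: comm_trans vw.
Qed.

Lemma comm_cons s u v : comm u v -> comm (s :: u) (s :: v).
Proof. exact: (comm_cat [:: s]). Qed.

Lemma comm_move s y z :
  (forall t, t \in y -> m s t = 2%N) -> comm (s :: y ++ z) (y ++ s :: z).
Proof.
elim: y => [|t y IH] cs; first exact: comm_refl.
apply: (@comm_trans [:: t, s & y ++ z]); first by apply/comm_swap/cs/mem_head.
by apply/comm_cons/IH => r ry; apply: cs; rewrite inE ry orbT.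
Qed.

Lemma comm_pi u v : comm u v -> pi u = pi v.
Proof.
elim=> {u v} [_ _ [x y s t m2]|//|u v w _ -> _ ->//].
by rewrite !pi_cat !pi_cons !pi_nil !mulg1 (gen_comm m2).
Qed.

Lemma comm_perm u v : comm u v -> perm_eq u v.
Proof.
elim=> {u v} [_ _ [x y s t m2]|//|u v w _ uv _ ].
  by rewrite perm_cat2l perm_cat2r -(cat1s s) -(cat1s t) perm_catC.
exact: perm_trans uv.
Qed.

Definition has_square (u : seq S) :=
  exists x s y, u = x ++ [:: s; s] ++ y.
Definition has_braid (u : seq S) :=
  exists x s t y, e s t /\ u = x ++ [:: s; t; s] ++ y.

Definition fc_word (u : seq S) :=
  forall v, comm u v -> ~ has_square v /\ ~ has_braid v.

Lemma fc_word_comm u v : comm u v -> fc_word u -> fc_word v.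
Proof. by move=> uv fu w vw; apply: fu; apply: comm_trans vw. Qed.

Lemma fc_word_behead s u : fc_word (s :: u) -> fc_word u.
Proof.
move=> fu v /(comm_cons s)/fu[nsq nbr]; split.
  by move=> [x [a [y ev]]]; apply: nsq; exists (s :: x), a, y; rewrite ev.
by move=> [x [a [b [y [ab ev]]]]]; apply: nbr; exists (s :: x), a, b, y; rewrite ev.
Qed.

Lemma fc_word_no_square s u v : fc_word u -> comm u [:: s, s & v] -> False.
Proof. by move=> fu /fu[+ _]; apply; exists [::], s, v. Qed.

Lemma fc_word_no_braid s t u v :
  fc_word u -> e s t -> comm u [:: s, t, s & v] -> False.
Proof. by move=> fu st /fu[_]; apply; exists [::], s, t, v. Qed.

(** Both claims are proved in one induction on the length, because reducedness of [s :: u] rests on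
    uniqueness of the class for [u]. *)
Lemma fc_word_reduced u : fc_word u ->
  reduced m u /\ (forall v, reduced m v -> pi v = pi u -> comm u v).
Proof.
have [n] := ubnP (size u); elim: n u => // n IHn [|s u] /=.
  move=> _ _; split=> // v rv ev.
  by have := rv [::] (esym ev); case: v {rv ev} => // _; apply: comm_refl.
rewrite ltnS => szu fsu; have fu := fc_word_behead fsu.
have [ru uniq_u] := IHn u szu fu.
(* Otherwise a reduced word [v] of the same element gives, by parity of the length, a reduced word
   [s :: v] for [u]; uniqueness for [u] then puts a square in the class of [s :: u]. *)
have rsu : reduced m (s :: u).
  have [v ev rv] := reduced_exists (pi (s :: u)).
  move=> v0 ev0; apply: leq_trans (rv v0 _); last by rewrite ev0 -ev.
  rewrite /= leqNgt; apply/negP; rewrite ltnS => lev.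
  have esv : pi (s :: v) = pi u by rewrite pi_cons ev pi_cons genK.
  have rsv : reduced m (s :: v).
    apply: (reduced_same ru esv); have := ru _ esv; have := odd_size_pi esv.
    by rewrite /=; lia.
  exact: fc_word_no_square fsu (comm_cons s (uniq_u _ rsv esv)).
split=> // [[|t v] rv ev].
  by have := rsu _ ev.
have szv : size v = size u by have := reduced_size rv rsu ev => -[].
have rv' := reduced_behead rv.
have [est|st] := eqVneq t s.
  move: ev; rewrite est !pi_cons => /mulgI ev; apply: comm_cons.
  exact: uniq_u.
(* Exchange puts [t] in front of [s :: u] at the cost of one letter. That letter is not the leading
   [s], which would force [t = s], so it lies in [u] and leaves [u2]. *)
have [x [a [y [eu etw]]]] := exchange rv ev.
case: x eu etw => [|c x] /= [].
  move=> _ eu.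
  rewrite pi_cons => /gen_mull; rewrite -eu => /mulIg /gen_inj E.
  by rewrite E eqxx in st.
move=> <- {c} eu; set u2 := x ++ y => /gen_mull.
rewrite -pi_cons => etw.
have sz2 : size u = (size u2).+1.
  by rewrite eu /u2 !size_cat /= addnS.
have rtsu : reduced m [:: t, s & u2].
  by apply: (reduced_same rsu (esym etw)); rewrite /= sz2.
(* In the commuting case [u] is equivalent to [t :: u2], so [t] moves to the front of [s :: u] and
   the induction applies to the shorter word [s :: u2]. *)
have [m2|] := eqVneq (m s t) 2%N.
  have e2 : pi (t :: u2) = pi u.
    apply: (@mulgI _ (gen s)); rewrite -!pi_cons etw !pi_cons.
    by rewrite !mulgA (gen_comm m2).
  have c1 : comm u (t :: u2).
    by apply: (uniq_u _ _ e2); apply: (reduced_same ru e2); rewrite /= sz2.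
  have c2 : comm (s :: u) [:: t, s & u2].
    exact: (comm_trans (comm_cons s c1) (comm_swap _ m2)).
  apply: (comm_trans c2); apply: comm_cons.
  have fsu2 := fc_word_behead (fc_word_comm c2 fsu).
  have sz3 : (size (s :: u2) < n)%N by rewrite /= -sz2.
  have [_] := IHn _ sz3 fsu2; apply=> //.
  by apply: (@mulgI _ (gen t)); rewrite -!pi_cons ev.
rewrite m_commute eq_sym st /= negbK => est; have m3 := m_edge est.
(* Second exchange, by [s] on [[:: t, s & u2]]. Deleting [t] contradicts reducedness; deleting [s]
   makes the two generators commute despite the braid relation; deleting a letter of [u2] makes [u]
   equivalent to a word beginning with [ts], hence a braid [sts] in the class of [s :: u]. *)
have [x' [b [y' [eu2 esw]]]] := exchange rsu etw.
move: esw; rewrite -etw pi_cons genK.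
case: x' eu2 => [|c [|d x']] /= [].
- move=> _ <- eu'; have e3 : pi u2 = pi (s :: u).
    by rewrite pi_cons eu' pi_cons genK.
  by have := rsu _ e3; rewrite /= sz2; lia.
- move=> <- _ <- eu'.
  have /mulIg est' : gen s * gen t * pi u2 = gen t * gen s * pi u2.
    have -> : gen t * gen s * pi u2 = pi (s :: u) by rewrite etw !pi_cons mulgA.
    by rewrite [RHS]pi_cons eu' pi_cons mulgA.
  have := gen_braid m3; rewrite mulgA est' -!mulgA => /mulgI /mulIg.
  by move/gen_inj => E; rewrite E eqxx in st.
move=> <- <- eu2 eu'; set u3 := x' ++ y' in eu'.
have c1 : comm u [:: t, s & u3].
  apply: (uniq_u _ _ (esym eu')); apply: (reduced_same ru (esym eu')).
  by rewrite /= sz2 eu2 /u3 !size_cat /= addnS.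
by case: (fc_word_no_braid fsu est (comm_cons s c1)).
Qed.

Lemma fully_commutativeP w :
  fully_commutative w <-> exists2 u, pi u = w & fc_word u.
Proof.
split=> [fw|[u <- fu]].
  have [u eu ru] := reduced_exists w; exists u => // v uv.
  have rv : reduced m v.
    by apply: (reduced_same ru); rewrite ?(comm_pi uv) ?(perm_size (comm_perm uv)).
  have ev : pi v = w by rewrite -(comm_pi uv).
  split=> [[x [s [y E]]]|[x [s [t [y [st E]]]]]].
    have exy : pi (x ++ y) = pi v by rewrite E !pi_cat !pi_cons mulg1 gen_sq mul1g.
    by have := rv _ exy; rewrite E !size_cat /=; lia.
  have m3 := m_edge st.
  (* Replacing [sts] by [tst] gives another reduced word of [w] with a different number of letters
     [s], whereas commutations preserve letter counts. *)
  pose v' := x ++ [:: t; s; t] ++ y.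
  have ev' : pi v' = pi v.
    by rewrite E /v' !pi_cat !pi_cons pi_nil !mulg1 (gen_braid m3).
  have rv' : reduced m v'.
    by apply: (reduced_same rv ev'); rewrite E /v' !size_cat.
  have /comm_perm/permP/(_ (pred1 s)) : comm v v'.
    by apply: fw; apply/reduced_exprP; rewrite ?ev'.
  rewrite E /v' !count_cat /= eqxx.
  have -> : (t == s) = false by apply/eqP => ts; rewrite ts e_irr in st.
  by lia.
have [ru uniq_u] := fc_word_reduced fu.
move=> v v' /reduced_exprP[ev rv] /reduced_exprP[ev' rv'].
by apply: (comm_trans (comm_sym (uniq_u v rv ev))); apply: uniq_u.
Qed.

Lemma fc_word_length u : fc_word u -> cox_length (pi u) = size u.
Proof.
move=> /fc_word_reduced[ru _].
by have /reduced_exprP[_ ->] : pi u = pi u /\ reduced m u by [].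
Qed.

Lemma fc_word_pi_inj u v : fc_word u -> fc_word v -> pi u = pi v -> comm u v.
Proof.
move=> /fc_word_reduced[_ uniq_u] /fc_word_reduced[rv _] euv.
exact: uniq_u.
Qed.

Lemma fc_word_involution u : fc_word u ->
  (pi u ^+ 2 = 1 <-> comm u (rev u)).
Proof.
move=> /fc_word_reduced[ru uniq_u]; rewrite expgS expg1; split=> [uu1|].
  have eu : pi (rev u) = pi u.
    by rewrite pi_rev -[LHS]mulg1 -uu1 mulgA mulVg mul1g.
  by apply: (uniq_u _ _ eu); apply: (reduced_same ru eu); rewrite size_rev.
by move/comm_pi; rewrite pi_rev => {1}->; rewrite mulVg.
Qed.

Lemma fc_involutionP k w : fc_involutions_of_length k w <->
  exists u, [/\ pi u = w, fc_word u, comm u (rev u) & size u = k].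
Proof.
split=> [[[/fully_commutativeP[u <- fu] /(fc_word_involution fu) cu] lw]|].
  by exists u; split=> //; rewrite -(fc_word_length fu).
move=> [u [<- fu cu szu]]; split; last by rewrite fc_word_length.
by split; [apply/fully_commutativeP; exists u | apply/fc_word_involution].
Qed.

(** The first letter [s] of [u] can be pulled to the front of [v]: a letter [t] not commuting with
    [s] and preceding the first [s] of [v] would make the projection of [v] onto [s], [t] begin with
    the wrong letter. *)
Lemma comm_projectionP u v :
  (forall s t, (s == t) || e s t ->
    filter (pred2 s t) u = filter (pred2 s t) v) <-> comm u v.
Proof.
split; last first.
  elim=> {u v} [_ _ [x y s t /eqP]|//|u v w _ uv _ vw s t st]; last first.
    by rewrite uv ?vw.
  rewrite m_commute => /andP[nst net] a b ab; rewrite !filter_cat /=.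
  case: ifP => [/pred2P es|_]; case: ifP => [/pred2P et|_] //.
  case: es et => es [] et; move: nst net ab; rewrite es et ?eqxx //=.
    by move=> /negbTE -> /negbTE ->.
  by rewrite eq_sym => /negbTE ->; rewrite e_sym => /negbTE->.
elim: u v => [|s u IHu] v uv.
  case: v uv => [|s v] uv; first exact: comm_refl.
  by have := uv s s; rewrite eqxx /= eqxx => /(_ isT).
have sv : s \in v.
  have := uv s s; rewrite eqxx /= eqxx => /(_ isT) E.
  have : s \in filter (pred2 s s) v by rewrite -E inE eqxx.
  by rewrite mem_filter => /andP[].
have [v1 [v2 [ev sv1]]] := split_first sv.
rewrite {}ev in uv sv *.
have commute t : t \in v1 -> m s t = 2%N.
  move=> tv1; apply/eqP; rewrite m_commute; apply/andP; split.
    by apply: contraNneq sv1 => ->.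
  apply/negP => st; have := uv s t; rewrite st orbT => /(_ isT).
  rewrite /= eqxx /= filter_cat.
  case E: (filter _ v1) => [|a l]; last first.
    case=> ea _; have : a \in filter (pred2 s t) v1 by rewrite E inE eqxx.
    by rewrite -ea mem_filter (negbTE sv1) andbF.
  have : t \in filter (pred2 s t) v1 by rewrite mem_filter tv1 /= eqxx orbT.
  by rewrite E.
apply: (comm_trans _ (comm_move v2 commute)); apply/comm_cons/IHu => a b ab.
have := uv a b ab; rewrite !filter_cat /=.
case: ifP => // sab.
suff -> : filter (pred2 a b) v1 = [::] by case.
apply/eqP; rewrite -[_ == _]negbK -has_filter; apply/hasPn => t tv1.
apply/negP => tab; have /eqP := commute t tv1; rewrite m_commute => /andP[nst net].
move: ab nst net; case/pred2P: sab => ->; case/pred2P: tab => ->; rewrite ?eqxx //.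
  by move=> /orP[->|->].
by rewrite eq_sym e_sym => /orP[->|->].
Qed.

End SimplyLacedWords.

(** * Alternating and palindromic sequences *)

Section Seq.
Variable T : eqType.
Implicit Types (a b : T) (l : seq T).

Lemma split_two (x : T) s : (2 <= count_mem x s)%N ->
  exists s1 s2 s3, s = s1 ++ x :: s2 ++ x :: s3 /\ x \notin s2.
Proof.
move=> c2; have xs : x \in s by rewrite -has_pred1 has_count; lia.
have [s1 [r [es xs1]]] := split_first xs.
have xr : x \in r.
  rewrite -has_pred1 has_count; move: c2; rewrite es count_cat /= eqxx.
  by rewrite (count_memPn xs1); lia.
have [s2 [s3 [er xs2]]] := split_first xr.
by exists s1, s2, s3; rewrite es er.
Qed.

Lemma filter_eq_cat (P : pred T) s p a r : filter P s = p ++ a :: r ->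
  exists x z, [/\ s = x ++ a :: z, filter P x = p & filter P z = r].
Proof.
elim: s p => [|c s IHs] p /=; first by case: p.
case: ifP => Pc E; last first.
  have [x [z [-> fx fz]]] := IHs _ E.
  by exists (c :: x), z; rewrite /= Pc.
case: p E => [[<- fs]|b p [<- E]]; first by exists [::], s.
have [x [z [-> fx fz]]] := IHs _ E.
by exists (c :: x), z; rewrite /= Pc fx.
Qed.

Lemma filter_pred2_diag a l : filter (pred2 a a) l = nseq (count_mem a l) a.
Proof. by elim: l => //= b l ->; case: eqVneq => [->|]. Qed.

Definition neq_rel : rel T := fun a b => a != b.

Lemma sorted_neqPn l : ~~ sorted neq_rel l ->
  exists p a r, l = p ++ [:: a, a & r].
Proof.
case: l => //= a l; elim: l a => //= b l IHl a.
rewrite negb_and negbK => /orP[/eqP <-|/IHl[p [c [r E]]]].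
  by exists [::], a, l.
by exists (a :: p), c, r; rewrite E.
Qed.

Fixpoint alt a b n : seq T := if n is n'.+1 then a :: alt b a n' else [::].

Lemma sorted_alt a b n : a != b -> sorted neq_rel (alt a b n).
Proof.
case: n => //= n; elim: n a b => //= n IHn a b ab.
by rewrite [neq_rel a b]ab IHn // eq_sym.
Qed.

Lemma alt_rcons a b n : alt a b n.+1 = rcons (alt a b n) (if odd n then b else a).
Proof.
by elim: n a b => // n IHn a b; rewrite [LHS]/= -/(alt b a n.+1) IHn /=; case: (odd n).
Qed.

Lemma rev_alt a b n : rev (alt a b n) = if odd n then alt a b n else alt b a n.
Proof.
elim: n a b => // n IHn a b; rewrite {1}alt_rcons rev_rcons IHn /=.
by case: (odd n).
Qed.

Lemma count_alt a b n : a != b ->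
  count_mem a (alt a b n) = uphalf n /\ count_mem b (alt a b n) = n./2.
Proof.
elim: n a b => // n IHn a b ab; have ba : b != a by rewrite eq_sym.
have [ca cb] := IHn _ _ ba.
by rewrite /= eqxx (negbTE ab) cb ca uphalf_half; split=> //; lia.
Qed.

Lemma sorted_neq_alt a b l : sorted neq_rel l -> all (pred2 a b) l ->
  l = alt a b (size l) \/ l = alt b a (size l).
Proof.
case: l => [|c l] /=; first by left.
move=> pl /andP[/pred2P cab al].
suff {cab} H d d' : all (pred2 d d') l -> path neq_rel d l -> l = alt d' d (size l).
  case: cab pl => -> pl; [left|right]; congr (_ :: _); apply: H => //.
  by apply: sub_all al => x /=; rewrite orbC.
elim: l d d' {c pl al} => //= c l IHl d d' /andP[/pred2P[->|-> {c}]].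
  by move=> _ /andP[]; rewrite /neq_rel eqxx.
move=> al /andP[_ pl]; congr (_ :: _); apply: IHl => //.
by apply: sub_all al => x /=; rewrite orbC.
Qed.

(** Adjacency in the half-line with a loop at 0. *)
Definition step : rel nat :=
  fun i j => [|| i.+1 == j, j.+1 == i | (i == 0) && (j == 0)].

(** An alternating palindrome is empty, which is the loop of [step], or has odd length; then the
    letter at both ends occurs once more than the other, so the counts determine the sequence. *)
Lemma alt_palindrome s t l : s != t -> sorted neq_rel l -> all (pred2 s t) l ->
  rev l = l -> let i := count_mem s l in let j := count_mem t l in
  step i j /\ l = if (j < i)%N then alt s t (i + j) else alt t s (i + j).
Proof.
move=> st sl al rl /=; have ts : t != s by rewrite eq_sym.
have [n szl] : exists n, size l = n by exists (size l).
have evenN a b : a != b -> l = alt a b n -> ~~ odd n -> n = 0.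
  move=> ab El en; move: rl; rewrite El rev_alt (negbTE en).
  by case: (n) => //= k [ba _]; rewrite ba eqxx in ab.
have := sorted_neq_alt sl al; rewrite szl => -[El|El].
  have [c1 c2] := count_alt n st; rewrite El c1 c2 /step.
  have [on|en] := boolP (odd n); last by rewrite (evenN _ _ st El en).
  have -> : (n./2 < uphalf n)%N by rewrite uphalf_half on; lia.
  have -> : (uphalf n + n./2)%N = n by rewrite uphalf_half; lia.
  by split=> //; apply/or3P; apply: Or32; rewrite uphalf_half on.
have [c1 c2] := count_alt n ts; rewrite El c1 c2 /step.
have [on|en] := boolP (odd n); last by rewrite (evenN _ _ ts El en).
have -> : (uphalf n < n./2)%N = false by rewrite uphalf_half on; lia.
have -> : (n./2 + uphalf n)%N = n by rewrite uphalf_half; lia.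
by split=> //; apply/or3P; apply: Or31; rewrite uphalf_half on.
Qed.

End Seq.

(** * Heights of self-dual words over graphs of degree at most 2 *)

Section Degree2.
Variables (S : finType) (e : rel S) (e_sym : symmetric e).
Hypothesis e_irr : irreflexive e.
Hypothesis deg2 : forall s t1 t2 t3,
  e s t1 -> e s t2 -> e s t3 -> [|| t1 == t2, t1 == t3 | t2 == t3].
Local Notation m := (simply_laced e_sym).
Local Notation pi := (@cox_pi S m).
Local Notation comm := (comm e_sym).
Local Notation fc_word := (fc_word e_sym).

(** Degree at most one: an isolated vertex, as in type A_1, is included. *)
Definition leaf s := forall t1 t2, e s t1 -> e s t2 -> t1 = t2.

(** Leaves need a separate bound: if [t] is the only neighbour of [s], the factor [sts] alternates
    on the only edge at [s]. *)
Definition alt_word (u : seq S) :=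
  (forall s t, e s t -> sorted (@neq_rel S) (filter (pred2 s t) u)) /\
  (forall s, leaf s -> (count_mem s u <= 1)%N).

Lemma edge_neq s t : e s t -> s != t.
Proof. by apply: contraTneq => ->; rewrite e_irr. Qed.

Lemma alt_word_comm u v : comm u v -> alt_word u -> alt_word v.
Proof.
move=> uv [au lu]; split=> [s t st|s ls].
  by have /comm_projectionP <- := uv; rewrite ?st ?orbT //; apply: au.
by have /permP <- := comm_perm uv; apply: lu.
Qed.

Lemma alt_word_no_square u : alt_word u -> ~ has_square u.
Proof.
move=> [au lu] [x [s [y E]]]; have [/lu|] := pselect (leaf s).
  by rewrite E count_cat /= eqxx; lia.
apply=> t1 t2 st1 _; have := au _ _ st1.
by rewrite E !filter_cat /= eqxx => /cat_sorted2[_] /=; rewrite /neq_rel eqxx.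
Qed.

(** A vertex [s] that is not a leaf has a neighbour other than [t], and on that edge [sts] projects
    to [ss]. *)
Lemma alt_word_no_braid u : alt_word u -> ~ has_braid e u.
Proof.
move=> [au lu] [x [s [t [y [st E]]]]]; have [/lu|] := pselect (leaf s).
  by rewrite E count_cat /= eqxx; lia.
suff unique t' : e s t' -> t' = t by apply=> t1 t2 /unique -> /unique ->.
move=> st'; apply/eqP; apply: contraT => tt'; have := au _ _ st'.
rewrite E !filter_cat /= eqxx [t == s]eq_sym (negbTE (edge_neq st)).
rewrite [t == t']eq_sym (negbTE tt') /=.
by move=> /cat_sorted2[_] /=; rewrite /neq_rel eqxx.
Qed.

Lemma alt_word_fc u : alt_word u -> fc_word u.
Proof.
move=> au v /alt_word_comm /(_ au) av.
by split; [apply: alt_word_no_square | apply: alt_word_no_braid].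
Qed.

(** With no neighbour of [s] in [y], the two copies of [s] can be brought together into a square;
    with exactly one, they close around it into a braid. *)
Lemma fc_word_gap u x s y z : fc_word u -> u = x ++ s :: y ++ s :: z ->
  s \notin y -> (2 <= count (e s) y)%N.
Proof.
move=> fu E sy; rewrite leqNgt; apply/negP => c1.
have com y' : {subset y' <= y} -> count (e s) y' = 0 ->
    forall t, t \in y' -> m s t = 2%N.
  move=> sub c0 t ty'; apply/eqP; rewrite m_commute //; apply/andP; split.
    by apply: contraNneq sy => ->; apply: sub.
  by move/eqP: c0; rewrite -leqn0 leqNgt -has_count => /hasPn; apply.
case: (posnP (count (e s) y)) => [c0|cp].
  have := comm_cat x (comm_move (s :: z) (com y (fun _ h => h) c0)).
  rewrite -E => /fu[+ _]; apply.
  by exists (x ++ y), s, z; rewrite -!catA.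
have [t ty st] : exists2 t, t \in y & e s t by apply/hasP; rewrite has_count.
case/splitPr: ty sy c1 com E => y1 y2 sy c1 com E.
move: c1; rewrite count_cat /= st => c1.
have [c01 c02] : count (e s) y1 = 0 /\ count (e s) y2 = 0 by lia.
have com1 : forall r, r \in y1 -> m s r = 2%N.
  by apply: com => // r; rewrite mem_cat => ->.
have com2 : forall r, r \in y2 -> m s r = 2%N.
  by apply: com => // r; rewrite mem_cat inE => ->; rewrite !orbT.
have cu : comm u (x ++ y1 ++ [:: s; t; s] ++ y2 ++ z).
  rewrite E -(catA y1); apply: comm_cat.
  apply: (comm_trans (comm_move _ com1)); apply: comm_cat.
  by rewrite /=; do 2 apply: comm_cons; apply/comm_sym/comm_move.
by have [_ []] := fu _ cu; exists (x ++ y1), s, t, (y2 ++ z); rewrite -!catA.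
Qed.

(* If the neighbours of s between two consecutive occurrences of s were all
   equal to t, then t would occur twice there without s in between, and t would
   again see only one neighbour: an infinite descent on the gap. *)
Lemma fc_word_gap_distinct u x s y z : fc_word u -> u = x ++ s :: y ++ s :: z ->
  s \notin y -> {in y &, forall t1 t2, e s t1 -> e s t2 -> t1 = t2} -> False.
Proof.
move=> fu; have [n] := ubnP (size y); elim: n x s y z => // n IHn x s y z.
rewrite ltnS => szy E sy only; have c2 := fc_word_gap fu E sy.
have [t ty st] : exists2 t, t \in y & e s t.
  by apply/hasP; rewrite has_count; apply: leq_trans c2.
have : (2 <= count_mem t y)%N.
  rewrite -(@eq_in_count _ (e s)) // => r ry /=.
  by apply/idP/eqP => [sr|->//]; apply: only.
case/split_two => y1 [y2 [y3 [Ey ty2]]].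
have sub r : r \in y2 -> r \in y.
  by move=> ry; rewrite Ey !(mem_cat, inE) ry !orbT.
apply: (IHn (x ++ s :: y1) t y2 (y3 ++ s :: z)) => //.
- by apply: leq_trans szy; rewrite Ey !size_cat /= size_cat /=; lia.
- by rewrite E Ey; do 4 rewrite -?catA ?cat_cons.
move=> t1 t2 /sub t1y /sub t2y tt1 tt2.
have ts : e t s by rewrite e_sym.
case/or3P: (deg2 tt1 tt2 ts) => /eqP // E'.
  by rewrite E' (negbTE sy) in t1y.
by rewrite E' (negbTE sy) in t2y.
Qed.

Lemma fc_word_alt u : fc_word u -> alt_word u.
Proof.
move=> fu; split=> [s t st|s ls].
  apply: contraT => /sorted_neqPn[p [a [r]]].
  move=> Ef; have ast : a \in [:: s; t].
    have : a \in filter (pred2 s t) u by rewrite Ef mem_cat mem_head orbT.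
    by rewrite mem_filter !inE => /andP[].
  case/filter_eq_cat: Ef => x [w [E _]]; rewrite -[a :: r]cat0s.
  case/filter_eq_cat => y [z [Ew fy _]].
  have ny b : b \in [:: s; t] -> b \notin y.
    move=> bst; apply/negP => yb.
    have : b \in filter (pred2 s t) y.
      by rewrite mem_filter yb andbT; move: bst; rewrite !inE.
    by rewrite fy.
  (* A repetition [aa] in the projection is a gap between two letters [a] that avoids one neighbour
     of [a]; the degree bound leaves at most one other neighbour inside the gap. *)
  case: (fc_word_gap_distinct fu (x := x) (s := a) (y := y) (z := z)).
  - by rewrite E Ew.
  - exact: ny.
  have [b bst ab] : exists2 b, b \in [:: s; t] & e a b.
    move: ast; rewrite !inE => /orP[]/eqP ->; first by exists t; rewrite // !inE eqxx orbT.
    by exists s; rewrite ?inE ?eqxx // e_sym.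
  move=> t1 t2 t1y t2y at1 at2.
  case/or3P: (deg2 at1 at2 ab) => /eqP // E'.
    by move: (ny b bst); rewrite -E' t1y.
  by move: (ny b bst); rewrite -E' t2y.
rewrite leqNgt; apply/negP => /split_two[x [y [z [E sy]]]].
by apply: (fc_word_gap_distinct fu E sy) => t1 t2 _ _; apply: ls.
Qed.

Definition valid_heights (h : S -> nat) :=
  (forall s t, e s t -> step (h s) (h t)) /\ (forall s, leaf s -> (h s <= 1)%N).

Lemma count_filter_mem (P : pred S) s u : P s ->
  count_mem s (filter P u) = count_mem s u.
Proof.
move=> Ps; rewrite count_filter; apply: eq_count => x /=.
by case: eqP => // ->.
Qed.

Lemma projection_palindrome u s t : comm u (rev u) -> (s == t) || e s t ->
  rev (filter (pred2 s t) u) = filter (pred2 s t) u.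
Proof. by move=> /comm_projectionP H st; rewrite -filter_rev H. Qed.

Lemma projection_heights u s t : alt_word u -> comm u (rev u) -> e s t ->
  let i := count_mem s u in let j := count_mem t u in
  step i j /\ filter (pred2 s t) u =
              if (j < i)%N then alt s t (i + j) else alt t s (i + j).
Proof.
move=> [au _] cu st; have rl := projection_palindrome cu (_ : (s == t) || e s t).
have := alt_palindrome (edge_neq st) (au s t st) (filter_all _ _) (rl _).
by rewrite !count_filter_mem /= ?eqxx ?orbT //; apply; rewrite st orbT.
Qed.

Lemma alt_word_heights u : alt_word u -> comm u (rev u) ->
  valid_heights (fun s => count_mem s u).
Proof.
move=> au cu; split=> [s t st|]; last by case: au.
by have [] := projection_heights au cu st.
Qed.

Lemma alt_word_heights_inj u v :
  alt_word u -> comm u (rev u) -> alt_word v -> comm v (rev v) ->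
  (forall s, count_mem s u = count_mem s v) -> comm u v.
Proof.
move=> au cu av cv huv; apply/comm_projectionP => s t /orP[/eqP <-|st].
  by rewrite !filter_pred2_diag huv.
have [_ ->] := projection_heights au cu st.
by have [_ ->] := projection_heights av cv st; rewrite !huv.
Qed.

(** The levels of [s] are symmetric about 0 and have the parity of [h s - 1], so the same letters
    occur at levels [l] and [-l]. *)
Definition layer (h : S -> nat) (l : nat) : seq S :=
  [seq s <- enum S | (l < h s)%N && odd (h s + l)].

(* The self-dual heap with h s letters s, the i-th of which sits at level
   2 i - (h s - 1), cut at the levels of absolute value at most B - 1. *)
Fixpoint layered_word (h : S -> nat) (B : nat) : seq S :=
  if B is l.+1 then
    layer h l ++ layered_word h l ++ (if l == 0 then [::] else layer h l)
  else [::].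

Lemma count_layer h l s : count_mem s (layer h l) = (l < h s)%N && odd (h s + l).
Proof.
rewrite count_uniq_mem; last exact/filter_uniq/enum_uniq.
by rewrite mem_filter mem_enum andbT.
Qed.

(** Among the levels of absolute value below [B], those of the right parity number [B] or
    [B - 1]. *)
Lemma count_layered_word h B s :
  count_mem s (layered_word h B) =
  if (B <= h s)%N then (B - odd (h s + B))%N else h s.
Proof.
elim: B => [|B IHB] //=; rewrite !count_cat IHB (fun_if (count_mem s)) /= count_layer.
have [lt|gt|eq] := ltngtP B (h s); rewrite ?addnS /=.
- by have [->|] := eqVneq B 0; case: (odd _) => /=; lia.
- by case: (B == 0); lia.
- by rewrite eq addnn odd_double /=; case: (_ == 0); lia.
Qed.

(** The levels of [s] and [t] have opposite parities and together fill the interval from [-h s] to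
    [h s], so each layer in that range holds exactly one of the two letters. *)
Lemma projection_layer h s t l : e s t -> h t = (h s).+1 ->
  filter (pred2 s t) (layer h l) =
  if (l < h t)%N then [:: if odd (h t + l) then t else s] else [::].
Proof.
move=> st hst; have nst := edge_neq st; rewrite -filter_predI.
case: ifP => [lt|ge]; last first.
  rewrite (eq_filter (a2 := pred0)) ?filter_pred0 // => x /=.
  by apply/negP => /andP[/pred2P[]-> /andP[]]; lia.
rewrite (eq_filter (a2 := pred1 (if odd (h t + l) then t else s))).
  by rewrite filter_pred1_uniq ?enum_uniq ?mem_enum.
move=> x /=; have [->|xs] := eqVneq x s; rewrite ?eqxx /=.
  case: ifP => o; first by rewrite (negbTE nst); lia.
  by rewrite eqxx; lia.
have [->|xt] := eqVneq x t => /=.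
  case: ifP => o; first by rewrite eqxx lt.
  by rewrite [t == s]eq_sym (negbTE nst) andbF.
by case: ifP => _; rewrite ?(negbTE xs) ?(negbTE xt).
Qed.

Lemma projection_layered_word h s t B : e s t -> h t = (h s).+1 ->
  filter (pred2 s t) (layered_word h B) =
  if (B <= h t)%N then
    (if odd (h t + B) then alt s t B.*2.-1 else alt t s B.*2.-1)
  else alt t s (h t).*2.-1.
Proof.
move=> st hst; elim: B => [|B IHB] /=; first by rewrite addn0; case: odd.
rewrite !filter_cat IHB (fun_if (filter (pred2 s t))) /= !projection_layer //.
have [lt|gt|eq] := ltngtP B (h t); rewrite ?addnS /= ?cats0.
- case: B lt {IHB} => [|B] lt /=; first by rewrite addn0; case: odd.
  have shift a b : alt a b B.*2 ++ [:: a] = a :: alt b a B.*2.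
    by rewrite cats1 -[RHS]/(alt a b B.*2.+1) alt_rcons odd_double.
  by rewrite addnS /=; case: (odd _); rewrite /= shift.
- by case: (B == 0); rewrite cats0.
- by rewrite eq addnn odd_double if_same cats0.
Qed.

Lemma layered_word_alt h B : valid_heights h -> (forall s, h s <= B)%N ->
  let u := layered_word h B in
  [/\ alt_word u, comm u (rev u) & forall s, count_mem s u = h s].
Proof.
move=> [hstep hleaf] hB u.
have cnt s : count_mem s u = h s.
  rewrite count_layered_word; case: ifP => // le.
  have -> : B = h s by apply/eqP; rewrite eqn_leq le hB.
  by rewrite addnn odd_double subn0.
have proj s t : e s t -> filter (pred2 s t) u = [::] \/
    exists a b n, [/\ a != b, odd n & filter (pred2 s t) u = alt a b n].
  have pred2C : filter (pred2 s t) u = filter (pred2 t s) u.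
    by apply: eq_filter => x /=; rewrite orbC.
  have main a b : e a b -> h b = (h a).+1 -> filter (pred2 a b) u = alt b a (h b).*2.-1.
    move=> ab hab; rewrite projection_layered_word //.
    case: ifP => // le; have -> : B = h b by apply/eqP; rewrite eqn_leq le hB.
    by rewrite addnn odd_double.
  have oddn n : odd n.+1.*2.-1 by rewrite doubleS /= odd_double.
  move=> st; have := hstep _ _ st; case/or3P => [/eqP E|/eqP E|/andP[/eqP s0 /eqP t0]].
  - right; exists t, s, (h t).*2.-1; rewrite (main s t) // eq_sym edge_neq //.
    by rewrite -E oddn.
  - right; exists s, t, (h s).*2.-1; rewrite pred2C (main t s) ?edge_neq //.
      by rewrite -E oddn.
    by rewrite e_sym.
  left; apply/eqP; rewrite -[_ == _]negbK -has_filter -all_predC; apply/allP => x xu /=.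
  by apply/negP => /orP[]/eqP E; move: xu; rewrite -has_pred1 has_count cnt E ?s0 ?t0.
split=> //; first split.
- by move=> s t /proj[->//|[a [b [n [ab _ ->]]]]]; apply: sorted_alt.
- by move=> s /hleaf; rewrite cnt.
apply/comm_projectionP => s t /orP[/eqP <-|/proj]; rewrite filter_rev.
  by rewrite filter_pred2_diag rev_nseq.
by case=> [->//|[a [b [n [_ on ->]]]]]; rewrite rev_alt on.
Qed.

Definition heights_elt (h : S -> nat) := pi (layered_word h (\max_s h s)).

Lemma layered_word_max_alt h : valid_heights h ->
  let u := layered_word h (\max_s h s) in
  [/\ alt_word u, comm u (rev u) & forall s, count_mem s u = h s].
Proof.
by move=> vh; apply: layered_word_alt => // s; apply: (leq_bigmax (F := h)).
Qed.

Lemma size_count_mem (u : seq S) : size u = \sum_s count_mem s u.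
Proof.
elim: u => [|a u IHu] /=; first by rewrite big1.
rewrite big_split /= -IHu (bigD1 a) //= eqxx big1 ?addn0 // => s.
by rewrite eq_sym => /negbTE ->.
Qed.

(** Counting involutions becomes enumerating height functions: [heights_elt] is injective because
    commutations preserve letter counts, and it reaches every fc involution because the counts
    determine the class. *)
Lemma fc_series_coef k (L : seq {ffun S -> nat}) : uniq L ->
  (forall h : {ffun S -> nat}, h \in L <-> valid_heights h /\ \sum_s h s = k) ->
  fps_coef (fc_series m) k = Posz (size L).
Proof.
move=> uL memL; rewrite /=; congr Posz.
pose elt (h : {ffun S -> nat}) := heights_elt h.
have inj : {in L &, injective elt}.
  move=> h h' /memL[vh _] /memL[vh' _] ehh'.
  have [au _ cu] := layered_word_max_alt vh.
  have [av _ cv] := layered_word_max_alt vh'.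
  have := fc_word_pi_inj e_irr (alt_word_fc au) (alt_word_fc av) ehh'.
  by move=> /comm_perm/permP huv; apply/ffunP => s; rewrite -cu -cv huv.
rewrite -(size_map elt) -(undup_id (_ : uniq (map elt L))); last first.
  by rewrite map_inj_in_uniq.
rewrite -card_fseq; congr #|` _|%fset; apply/fsetP => w.
rewrite in_fset_set; last exact: fc_involutions_of_length_finite.
rewrite in_fset /=; apply/idP/mapP; rewrite in_setE.
  move=> /fc_involutionP -/(_ e_irr)[u [<- fu cu szu]].
  have au := fc_word_alt fu; have vu := alt_word_heights au cu.
  pose h := [ffun s => count_mem s u].
  have hE s : h s = count_mem s u by rewrite ffunE.
  have vh : valid_heights h.
    by case: vu => v1 v2; split=> [s t|s]; rewrite !hE; [apply: v1|apply: v2].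
  exists h; first apply/memL.
    by split=> //; rewrite -szu size_count_mem; apply: eq_bigr => s _.
  have [av cv cnt] := layered_word_max_alt vh.
  by apply: comm_pi; apply: alt_word_heights_inj => // s; rewrite cnt hE.
move=> [h /memL[vh sumh] ->]; apply/fc_involutionP => //.
have [av cv cnt] := layered_word_max_alt vh.
exists (layered_word h (\max_s h s)); split=> //; first exact: alt_word_fc.
by rewrite size_count_mem -sumh; apply: eq_bigr => s _.
Qed.

End Degree2.

(** * Signed matchings and walks on the half-line *)

Definition nbrs (i : nat) : seq nat :=
  if i is i'.+1 then [:: i'; i.+1] else [:: 0; 1].

Section Series.
Local Open Scope ring_scope.
Local Notation F := (fps (fps int)).

(** * Coefficient rules and the derivation x d/dx *)

Section Coefficients.
Variable R : comNzRingType.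
Implicit Types f g : fps R.

Lemma fps_coefD f g n : fps_coef (f + g) n = fps_coef f n + fps_coef g n.
Proof. by []. Qed.

Lemma fps_coefN f n : fps_coef (- f) n = - fps_coef f n.
Proof. by []. Qed.

Lemma fps_coef_sum (I : Type) (r : seq I) (Q : pred I) (G : I -> fps R) n :
  fps_coef (\sum_(i <- r | Q i) G i) n = \sum_(i <- r | Q i) fps_coef (G i) n.
Proof. by elim/big_ind2: _ => // _ f _ g <- <-. Qed.

Definition fps_linear (c : R) : fps R := Fps (fun n => if n == 1%N then c else 0).

Lemma fps_coef_linearM0 c f : fps_coef (fps_linear c * f) 0 = 0.
Proof. by rewrite fps_coefM big_ord1 mul0r. Qed.

Lemma fps_coef_linearMS c f n :
  fps_coef (fps_linear c * f) n.+1 = c * fps_coef f n.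
Proof.
rewrite fps_coefM 2!big_ord_recl /= mul0r add0r subn1 big1 ?addr0 // => i _.
by rewrite /= mul0r.
Qed.

Lemma fpsX_linear : fpsX = fps_linear (1 : R).
Proof. by apply/fpsP => n /=; case: eqP. Qed.

Lemma fps_coefXn d n : fps_coef (fpsX ^+ d : fps R) n = (n == d)%:R.
Proof.
rewrite fpsX_linear; elim: d n => [|d IHd] [|n] //; rewrite exprS.
  by rewrite fps_coef_linearM0.
by rewrite fps_coef_linearMS mul1r IHd eqSS.
Qed.

Lemma fps_coefXnM d f n :
  fps_coef (fpsX ^+ d * f) n = if (n < d)%N then 0 else fps_coef f (n - d).
Proof.
rewrite fpsX_linear; elim: d n => [|d IHd] n; first by rewrite mul1r subn0.
rewrite exprS -mulrA; case: n => [|n]; first by rewrite fps_coef_linearM0.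
by rewrite fps_coef_linearMS mul1r IHd ltnS subSS.
Qed.

Definition euler f : fps R := Fps (fun n => fps_coef f n *+ n).

Lemma fps_coef_euler f n : fps_coef (euler f) n = fps_coef f n *+ n.
Proof. by []. Qed.

Lemma eulerE f : euler f = fpsX * fps_deriv f.
Proof.
apply/fpsP => -[|n]; rewrite fpsX_linear; first by rewrite fps_coef_linearM0.
by rewrite fps_coef_linearMS mul1r.
Qed.

Lemma eulerB f g : euler (f - g) = euler f - euler g.
Proof.
by apply/fpsP => n; rewrite fps_coefD fps_coefN !fps_coef_euler mulrnBl.
Qed.

Lemma eulerM f g : euler (f * g) = euler f * g + f * euler g.
Proof.
apply/fpsP => n; rewrite fps_coefD fps_coef_euler !fps_coefM -sumrMnl -big_split /=.
apply: eq_bigr => i _; rewrite mulrnAl mulrnAr -mulrnDr subnKC //.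
by rewrite -ltnS.
Qed.

Lemma euler1 : euler 1 = 0.
Proof.
by apply/fpsP => -[|n]; rewrite fps_coef_euler ?mulr0n // fps_coef1 mul0rn.
Qed.

Lemma euler_linear c : euler (fps_linear c) = fps_linear c.
Proof.
by apply/fpsP => -[|[|n]]; rewrite fps_coef_euler ?mulr0n ?mulr1n //= mul0rn.
Qed.

End Coefficients.

(* Weight of a vertex at height h of a walk, x marking the length. *)
Definition wt (h : nat) : F := fps_linear (q ^+ h).

(* Signed matchings of the half-line h, h+1, ... with weight wt i wt (i+1) on the
   edge {i, i+1}. *)
Definition Mhigh (h : nat) : F := Fps (fun n =>
  if odd n then 0 else
  (-1) ^+ n./2 * q ^+ (h * n) * q ^+ 'C(n, 2) / qpoch2 (q ^+ 2) n./2).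

(* Signed partial matchings of 0, ..., h-1 where 0 may also carry a loop. *)
Fixpoint Mlow (h : nat) : F :=
  if h is h1.+1 then
    if h1 is h2.+1 then Mlow h1 - wt h2 * wt h1 * Mlow h2 else 1 - wt 0
  else 1.

Lemma euler_wt h : euler (wt h) = wt h.
Proof. exact: euler_linear. Qed.

Lemma Mlow_rec h : Mlow h.+2 = Mlow h.+1 - wt h * wt h.+1 * Mlow h.
Proof. by []. Qed.

Lemma qpoch2S k :
  qpoch2 (q ^+ 2) k.+1 = qpoch2 (q ^+ 2) k * (1 - q ^+ k.+1.*2).
Proof.
by rewrite /qpoch2 big_ord_recr /= -exprD; congr (_ * (1 - q ^+ _)); lia.
Qed.

Lemma bin2_double k : 'C(k.*2, 2) = (k * k.*2.-1)%N.
Proof. by rewrite bin2 -doubleMl doubleK. Qed.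

(** Vertex [h] is either unmatched or matched with [h + 1]. [Mhigh] is given in closed form, so the
    recursion is checked on coefficients. *)
Lemma Mhigh_rec h : Mhigh h = Mhigh h.+1 - wt h * wt h.+1 * Mhigh h.+2.
Proof.
apply/fpsP => n; rewrite fps_coefD fps_coefN -mulrA.
case: n => [|[|n]].
- by rewrite fps_coef_linearM0 subr0 /= !muln0.
- by rewrite fps_coef_linearMS fps_coef_linearM0 mulr0 subr0.
rewrite 2!fps_coef_linearMS [fps_coef (Mhigh _) n.+2]/= [fps_coef (Mhigh _) n]/=.
rewrite [fps_coef (Mhigh _) n.+2]/= negbK.
case: ifP => [_|/negbT/even_halfK <-]; first by rewrite !mulr0 subr0.
set k := n./2; rewrite doubleK -doubleS.
have U := qpoch2_unit k.
have U1 : 1 - q ^+ k.+1.*2 \is a GRing.unit.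
  by have := qpoch2_unit k.+1; rewrite qpoch2S unitrM => /andP[].
rewrite qpoch2S !invrM // !bin2_double.
have exponents : (h + h.+1 + h.+2 * k.*2 + k * k.*2.-1 =
                  h * k.+1.*2 + k.+1 * k.+1.*2.-1)%N.
  by rewrite doubleS /=; case: (k) => [|j]; rewrite ?doubleS /=; nia.
have -> : q ^+ h * (q ^+ h.+1 * ((-1) ^+ k * q ^+ (h.+2 * k.*2) *
            q ^+ (k * k.*2.-1) / qpoch2 (q ^+ 2) k)) =
          (-1) ^+ k * q ^+ (h * k.+1.*2) * q ^+ (k.+1 * k.+1.*2.-1) /
            qpoch2 (q ^+ 2) k.
  by rewrite -[in RHS](mulrA ((-1) ^+ k)) -exprD -exponents !exprD; ring.
have -> : (h.+1 * k.+1.*2 = h * k.+1.*2 + k.+1.*2)%N by rewrite mulSn addnC.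
rewrite exprD [(-1) ^+ k.+1]exprS; have := mulrV U1.
move: (1 - q ^+ k.+1.*2)^-1 (qpoch2 (q ^+ 2) k)^-1 => d c.
move: (q ^+ k.+1.*2) (q ^+ (h * k.+1.*2)) (q ^+ (k.+1 * k.+1.*2.-1)).
move: ((-1) ^+ k) => s Q A B dQ.
(* Here [Q] stands for [q^(2k+2)] and [d] for the inverse of [1 - Q]; the two sides differ by a
   multiple of [1 - (1 - Q) * d]. *)
apply/eqP; rewrite -subr_eq0.
have -> : -1 * s * A * B * (d * c) - (-1 * s * (A * Q) * B * (d * c) - s * A * B * c)
   = s * A * B * c * (1 - (1 - Q) * d) by ring.
by rewrite dQ subrr mulr0.
Qed.

Lemma Mhigh_odd h k : fps_coef (Mhigh h) k.*2.+1 = 0.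
Proof. by rewrite /= odd_double. Qed.

Lemma Mhigh_even h k : fps_coef (Mhigh h) k.*2 =
  (-1) ^+ k * q ^+ (h * k.*2) * q ^+ 'C(k.*2, 2) / qpoch2 (q ^+ 2) k.
Proof. by rewrite /= odd_double doubleK. Qed.

Lemma J_even k : fps_coef J k.*2 =
  (-1) ^+ k * q ^+ 'C(k.*2, 2) / qpoch2 (q ^+ 2) k.
Proof. by rewrite /= uphalf_double doubleK. Qed.

Lemma J_odd k : fps_coef J k.*2.+1 =
  (-1) ^+ k.+1 * (q ^+ 'C(k.*2, 2) * q ^+ k.*2) / qpoch2 (q ^+ 2) k.
Proof. by rewrite /= doubleK uphalf_double binS bin1 exprD. Qed.

Variant parity_spec : nat -> Type :=
| ParityEven k : parity_spec k.*2
| ParityOdd k : parity_spec k.*2.+1.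

Lemma parityP n : parity_spec n.
Proof. by rewrite -(odd_double_half n); case: odd; constructor. Qed.

(** Vertex 0 carries its loop, of signed weight [- wt 0], or does not. *)
Lemma J_Mhigh : J = Mhigh 0 - wt 0 * Mhigh 1.
Proof.
apply/fpsP => n; rewrite fps_coefD fps_coefN; case/parityP: n => k.
  rewrite J_even Mhigh_even mul0n expr0 mulr1; case: k => [|k].
    by rewrite fps_coef_linearM0 subr0.
  by rewrite doubleS fps_coef_linearMS Mhigh_odd mulr0 subr0.
rewrite fps_coef_linearMS J_odd Mhigh_odd Mhigh_even expr0 mul1r mul1n exprS; ring.
Qed.

(** Substituting -qx for x turns [wt h] into [- wt h.+1]: the half-line moves up by one, edge
    weights keep their sign and the loop changes sign. *)
Lemma J_scale : fps_scale (- q) J = Mhigh 1 + wt 1 * Mhigh 2.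
Proof.
apply/fpsP => n; rewrite fps_coefD -[LHS]/((- q) ^+ n * fps_coef J n).
have sq k : (- q) ^+ k.*2 = q ^+ k.*2 by rewrite -mul2n !exprM sqrrN.
case/parityP: n => k.
  rewrite J_even Mhigh_even mul1n; case: k => [|k].
    by rewrite fps_coef_linearM0 addr0 !expr0 !mul1r.
  rewrite doubleS fps_coef_linearMS Mhigh_odd mulr0 addr0 -doubleS.
  by rewrite sq; ring.
rewrite fps_coef_linearMS J_odd Mhigh_odd Mhigh_even add0r.
have -> : (2 * k.*2 = k.*2 + k.*2)%N by rewrite mul2n addnn.
by rewrite exprS sq exprD expr1 exprS; ring.
Qed.

Lemma J_Mlow_Mhigh h : J = Mlow h.+1 * Mhigh h.+1 - wt h * wt h.+1 * Mlow h * Mhigh h.+2.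
Proof.
elim: h => [|h IHh]; first by rewrite J_Mhigh (Mhigh_rec 0) /=; ring.
by rewrite IHh Mlow_rec (Mhigh_rec h.+1); ring.
Qed.

(** Removing the matchings that leave [i] uncovered keeps those covering [i], so a matching is
    weighted by its number of covered vertices up to [N]. [euler] counts the same, each covered
    vertex bringing one x; an edge from [N] to [N + 1] contributes only [N], whence the extra
    [Mlow N]. *)
Lemma sum_J_Mlow_Mhigh N : \sum_(i < N.+1) (J - Mlow i * Mhigh i.+1) =
  euler (Mlow N.+1) * Mhigh N.+1 - wt N * wt N.+1 * (euler (Mlow N) + Mlow N) * Mhigh N.+2.
Proof.
elim: N => [|N IHN].
  rewrite big_ord1 (J_Mlow_Mhigh 0) /= eulerB euler1 euler_wt; ring.
rewrite big_ord_recr /= {}IHN (J_Mlow_Mhigh N.+1) -/(Mlow N.+1).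
rewrite eulerB !eulerM !euler_wt (Mhigh_rec N.+1) Mlow_rec; ring.
Qed.

(** Divisibility by [q^N], the congruence under which the infinite sum over vertices is
    truncated. *)
Definition q_small (N : nat) (f : F) :=
  forall n k, (k < N)%N -> fps_coef (fps_coef f n) k = 0.

Lemma q_smallD N f g : q_small N f -> q_small N g -> q_small N (f + g).
Proof.
by move=> sf sg n k kN; rewrite fps_coefD -[LHS]/(_ + _) sf // sg // addr0.
Qed.

Lemma q_smallM N f g : q_small N f -> q_small N (f * g).
Proof.
move=> sf n k kN; rewrite fps_coefM fps_coef_sum big1 // => i _.
rewrite fps_coefM big1 // => j _; rewrite sf ?mul0r //.
by apply: leq_trans kN; rewrite ltnS -ltnS.
Qed.

Lemma q_small_wt N : q_small N (wt N).
Proof.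
by move=> n k kN /=; case: eqP => // _; rewrite fps_coefXn ltn_eqF.
Qed.

Lemma q_small_euler_Mhigh N : q_small N (euler (Mhigh N)).
Proof.
move=> n k kN; rewrite fps_coef_euler; case/parityP: n => j; last first.
  by rewrite Mhigh_odd mul0rn.
(* [euler] kills the constant term; all other coefficients of [Mhigh N] carry a factor [q^N]. *)
case: j => [//|j]; rewrite -mulr_natl Mhigh_even !mulrA (mulrC _ (q ^+ (N * _))).
by rewrite -!mulrA fps_coefXnM; case: ltnP => //; nia.
Qed.

(** What remains comes from covered vertices above [N], and each of these brings a factor
    [q^(N+1)]. *)
Lemma euler_J_small N :
  q_small N.+1 (euler J - \sum_(i < N.+1) (J - Mlow i * Mhigh i.+1)).
Proof.
rewrite sum_J_Mlow_Mhigh {1}(J_Mlow_Mhigh N) eulerB !eulerM !euler_wt.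
have -> : euler (Mlow N.+1) * Mhigh N.+1 + Mlow N.+1 * euler (Mhigh N.+1) -
    (((wt N * wt N.+1 + wt N * wt N.+1) * Mlow N + wt N * wt N.+1 * euler (Mlow N)) * Mhigh N.+2 +
     wt N * wt N.+1 * Mlow N * euler (Mhigh N.+2)) -
    (euler (Mlow N.+1) * Mhigh N.+1 - wt N * wt N.+1 * (euler (Mlow N) + Mlow N) * Mhigh N.+2) =
  euler (Mhigh N.+1) * Mlow N.+1 + wt N.+1 * (- (wt N * Mlow N * (Mhigh N.+2 + euler (Mhigh N.+2)))).
  by ring.
by apply: q_smallD; apply: q_smallM; [apply: q_small_euler_Mhigh | apply: q_small_wt].
Qed.

(** Only the heights from which a step departs are weighted, so a closed walk counts its starting
    height once. *)
Fixpoint walk_gf (j n i : nat) : fps int :=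
  if n is n'.+1 then q ^+ i * \sum_(i' <- nbrs i) walk_gf j n' i'
  else (i == j)%:R.

Definition walk_series (j i : nat) : F := Fps (fun n => walk_gf j n i).

Lemma walk_series_rec j i :
  walk_series j i = (i == j)%:R + wt i * \sum_(i' <- nbrs i) walk_series j i'.
Proof.
apply/fpsP => -[|n]; rewrite fps_coefD ?fps_coef_linearM0 ?fps_coef_linearMS.
  by rewrite addr0 /=; case: eqP.
rewrite fps_coef_sum /=.
have -> : fps_coef ((i == j)%:R : F) n.+1 = 0 by case: eqP.
by rewrite add0r.
Qed.

(** The factor [wt i] raises the degree in x, so the coefficients vanish one after another. *)
Lemma transfer_unique (D : nat -> F) :
  (forall i, D i = wt i * \sum_(i' <- nbrs i) D i') -> forall i, D i = 0.
Proof.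
move=> DE i; apply/fpsP => n; elim: n i => [|n IHn] i; rewrite DE.
  by rewrite fps_coef_linearM0.
by rewrite fps_coef_linearMS fps_coef_sum big1_seq ?mulr0.
Qed.

(* J times the (i, j) entry of (1 - x D T)^(-1). *)
Definition green (j i : nat) : F :=
  if (i <= j)%N then (\prod_(i <= h < j) wt h) * Mlow i * Mhigh j.+1
  else Mlow j * (\prod_(j.+1 <= h < i.+1) wt h) * Mhigh i.+1.

Lemma green_le j i : (i <= j)%N ->
  green j i = (\prod_(i <= h < j) wt h) * Mlow i * Mhigh j.+1.
Proof. by rewrite /green => ->. Qed.

Lemma green_ge j i : (j <= i)%N ->
  green j i = Mlow j * (\prod_(j.+1 <= h < i.+1) wt h) * Mhigh i.+1.
Proof.
rewrite /green leq_eqVlt => /predU1P[->|ji]; last by rewrite leqNgt ji.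
by rewrite leqnn !big_geq // mul1r mulr1.
Qed.

(** Off the diagonal this reduces to the recursion of [Mlow] or of [Mhigh]; on the diagonal it is
    [J] cut at vertex [j]. *)
Lemma green_rec j i :
  green j i = J * (i == j)%:R + wt i * \sum_(i' <- nbrs i) green j i'.
Proof.
case: (ltngtP i j) => [ij|ji|->]; rewrite ?mulr0 ?add0r ?mulr1.
- case: i ij => [|i] ij; rewrite /= !big_cons big_nil addr0.
    by rewrite !green_le // (big_ltn ij) /=; ring.
  by rewrite !green_le ?(ltnW ij) ?(ltnW (ltnW ij)) // (@big_ltn _ _ _ i)
    ?(ltnW ij) // (big_ltn ij) Mlow_rec; ring.
- case: i ji => [//|i] ji; rewrite /= !big_cons big_nil addr0.
  have [ji1 ji2] : (j <= i.+1)%N /\ (j <= i.+2)%N by lia.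
  rewrite (green_ge ji1) (green_ge ji2) (@green_ge j i) //.
  rewrite (@big_nat_recr _ _ _ i.+2 j.+1) // (@big_nat_recr _ _ _ i.+1 j.+1) //=.
  by rewrite (Mhigh_rec i.+1); ring.
case: j => [|j]; rewrite /= !big_cons big_nil addr0.
  rewrite [green 0 0]green_le // green_ge // big_geq // big_nat1 J_Mhigh (Mhigh_rec 0) /=.
  by ring.
rewrite (@green_le _ j.+1) // (@green_le _ j) // (@green_ge _ j.+2) //.
by rewrite !big_nat1 big_geq // (J_Mlow_Mhigh j.+1) Mlow_rec; ring.
Qed.

Lemma walk_series_green j i : J * walk_series j i = green j i.
Proof.
apply/eqP; rewrite -subr_eq0; apply/eqP.
apply: (@transfer_unique (fun i => J * walk_series j i - green j i)) => {}i.
rewrite sumrB -mulr_sumr {1}walk_series_rec green_rec; ring.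
Qed.

End Series.

(** * Generating functions of open and closed walks *)

Section SeriesResults.
Local Open Scope ring_scope.

Lemma open_walk_series :
  Fps (fun n => walk_gf 0 n.+1 0) = fps_scale (- q) J / J.
Proof.
set A := Fps _; apply: (mulIr J_unit); rewrite mulrVK ?J_unit //.
(* [wt 0] is x itself, so it only shifts the index by one. *)
have walkA : walk_series 0 0 = 1 + wt 0 * A.
  apply/fpsP => -[|n]; rewrite fps_coefD ?fps_coef_linearM0 ?addr0 //.
  by rewrite fps_coef_linearMS fps_coef1 add0r expr0 mul1r.
have : wt 0 * (A * J) = wt 0 * (Mhigh 1 + wt 1 * Mhigh 2).
  have := walk_series_green 0 0; rewrite walkA green_le // big_geq //= !mul1r.
  have -> : wt 0 * (A * J) = J * (1 + wt 0 * A) - J by ring.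
  by move=> ->; rewrite J_Mhigh (Mhigh_rec 0); ring.
rewrite J_scale => /fpsP zA; apply/fpsP => n; have := zA n.+1.
by rewrite !fps_coef_linearMS expr0 !mul1r.
Qed.

(** This is the trace formula modulo [q^(k+1)], where starting heights up to [k] suffice; for
    positive [n] the constants 1 in [1 - walk_series i i] do not contribute. *)
Lemma closed_walk_series n k : (0 < n)%N ->
  fps_coef (fps_coef (- fpsX * (fps_deriv J / J)) n) k =
  \sum_(i < k.+1) fps_coef (walk_gf i n i) k.
Proof.
move=> n0; rewrite mulNr mulrA -eulerE.
have := q_smallM J^-1 (@euler_J_small k).
have -> : (euler J - \sum_(i < k.+1) (J - Mlow i * Mhigh i.+1)) / J =
          euler J / J - \sum_(i < k.+1) (1 - walk_series i i).
  rewrite mulrBl mulr_suml; congr (_ - _); apply: eq_bigr => i _.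
  have := walk_series_green i i; rewrite green_le // big_geq // mul1r => <-.
  by rewrite mulrBl divrr ?J_unit // mulrAC divrr ?J_unit // mul1r.
move: (euler J / J) => f /(_ n k (ltnSn k)).
rewrite !fps_coefD !fps_coefN !fps_coef_sum => /eqP; rewrite subr_eq0 => /eqP ->.
rewrite -sumrN; apply: eq_bigr => i _.
rewrite !fps_coefD !fps_coefN fps_coef1.
by case: n n0 => // n _; rewrite add0r opprK.
Qed.

End SeriesResults.

(** * Heights as walks *)

Lemma step_sym : symmetric step.
Proof. by move=> i j; rewrite /step andbC; case: (i.+1 == j); rewrite ?orbT. Qed.

Lemma step_nbrs i j : step i j = (j \in nbrs i).
Proof. by case: i => [|i]; rewrite /step /= !inE; lia. Qed.

Lemma uniq_nbrs i : uniq (nbrs i).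
Proof. by case: i => [|i] //=; rewrite inE; lia. Qed.

Fixpoint walks (n i : nat) : seq (seq nat) :=
  if n is n'.+1 then [seq j :: p | j <- nbrs i, p <- walks n' j] else [:: [::]].

Lemma mem_walks n i p : (p \in walks n i) = (size p == n) && path step i p.
Proof.
elim: n i p => [|n IHn] i p; first by case: p.
apply/allpairsPdep/andP => [[j [p' [ji pj ->]]]|].
  by move: pj; rewrite IHn /= step_nbrs ji eqSS => /andP[].
case: p => [|j p] [] //=; rewrite eqSS => sz /andP[ij jp].
by exists j, p; rewrite IHn sz jp -step_nbrs.
Qed.

Lemma uniq_walks n i : uniq (walks n i).
Proof.
elim: n i => // n IHn i; apply: allpairs_uniq_dep => //; first exact: uniq_nbrs.
by move=> [j p] [j' p'] /= _ _ [-> ->].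
Qed.

(** A walk is stored without its starting height; [belast i p] restores it and drops the end,
    matching the weight in [walk_gf]. *)
Definition walks_to (n i j k : nat) : seq (seq nat) :=
  [seq p <- walks n i | (last i p == j) && (sumn (belast i p) == k)].

Section WalkCount.
Local Open Scope ring_scope.

Lemma walk_gfE j n i :
  walk_gf j n i = \sum_(p <- walks n i | last i p == j) q ^+ sumn (belast i p).
Proof.
elim: n i => [|n IHn] i /=; first by rewrite big_cons big_nil; case: eqP => //= _; rewrite addr0.
rewrite [RHS]big_mkcond big_allpairs_dep mulr_sumr; apply: eq_bigr => i' _.
rewrite IHn [in LHS]big_mkcond mulr_sumr; apply: eq_bigr => p _ /=.
by case: ifP; rewrite ?mulr0 // exprD.
Qed.

Lemma fps_coef_walk_gf j n i k :
  fps_coef (walk_gf j n i) k = Posz (size (walks_to n i j k)).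
Proof.
rewrite walk_gfE fps_coef_sum size_filter -sum1_count.
rewrite -natz natr_sum big_mkcond [RHS]big_mkcond; apply: eq_bigr => p _.
by rewrite fps_coefXn [k == _]eq_sym; case: (last i p == j); case: eqP.
Qed.

End WalkCount.

(** * Height functions as sequences of natural numbers *)

Section Ordinal.
Variables (n : nat) (e : rel 'I_n) (e_sym : symmetric e).
Hypothesis e_irr : irreflexive e.
Hypothesis deg2 : forall s t1 t2 t3,
  e s t1 -> e s t2 -> e s t3 -> [|| t1 == t2, t1 == t3 | t2 == t3].

Lemma fc_series_coef_seq k (L : seq (seq nat)) : uniq L ->
  (forall p, p \in L <-> [/\ size p = n,
     valid_heights e (fun i => nth 0 p i) & sumn p = k]) ->
  fps_coef (fc_series (simply_laced e_sym)) k = Posz (size L).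
Proof.
move=> uL memL; pose g (p : seq nat) := [ffun i : 'I_n => nth 0 p i].
have gE p : (g p : 'I_n -> nat) = fun i => nth 0 p i.
  by apply/funext => i; rewrite ffunE.
have sum_g p : size p = n -> \sum_i g p i = sumn p.
  move=> sp; rewrite sumnE (big_nth 0) sp big_mkord; apply: eq_bigr => i _.
  by rewrite ffunE.
rewrite -(size_map g); apply: fc_series_coef => //.
  rewrite map_inj_in_uniq // => p p' /memL[sp _ _] /memL[sp' _ _] /ffunP gpp'.
  apply: (@eq_from_nth _ 0); rewrite sp ?sp' // => i lt_in.
  by have := gpp' (Ordinal lt_in); rewrite !ffunE.
move=> h; split=> [/mapP[p /memL[sp vp <-] ->]|[vh sumh]].
  by split; [rewrite gE | rewrite sum_g].
pose p := [seq h i | i <- enum 'I_n].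
have sp : size p = n by rewrite size_map size_enum_ord.
have hp : h = g p.
  apply/ffunP => i; rewrite ffunE (nth_map i) ?size_enum_ord //.
  by rewrite nth_ord_enum.
rewrite hp; apply: map_f; apply/memL; split=> //.
  by rewrite -gE -hp.
by rewrite -sum_g // -hp.
Qed.

End Ordinal.

(** The leaves are the end vertices, and a height at most 1 is exactly a height adjacent to 0, so
    the leaf bound becomes a step to an added 0 at each end. *)
Lemma path_valid_heights n p : size p = n ->
  valid_heights (@path_adj n) (fun i => nth 0 p i) <-> path step 0 (rcons p 0).
Proof.
move=> sp; split.
  move=> [hstep hleaf]; apply/(pathP 0) => i; rewrite size_rcons sp ltnS => lt_in.
  rewrite nth_rcons_default; case: i lt_in => [_|i lt_in] /=.
    case: n sp hstep hleaf => [|n] sp _ hleaf; first by rewrite nth_default ?sp.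
    have : nth 0 p (@ord0 n) <= 1.
      by apply: hleaf => t1 t2 /= e1 e2; apply: val_inj; move: e1 e2; rewrite /path_adj /=; lia.
    by rewrite /step /=; lia.
  rewrite nth_rcons_default.
  have [eq|ne] := eqVneq i.+1 n; last first.
    have lt1 : i.+1 < n by lia.
    apply: (hstep (Ordinal lt_in) (Ordinal lt1)); rewrite /path_adj /= eqxx //.
  rewrite [nth 0 p i.+1]nth_default ?sp ?eq //.
  have : nth 0 p (Ordinal lt_in) <= 1.
    apply: hleaf => t1 t2 e1 e2; apply: val_inj; move: e1 e2.
    by rewrite /path_adj /=; have := ltn_ord t1; have := ltn_ord t2; lia.
  by rewrite /step /=; lia.
move/(pathP 0) => H.
have H1 i : i <= n -> step (nth 0 (0 :: p) i) (nth 0 p i).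
  move=> le_in; have := H i; rewrite size_rcons sp ltnS le_in => /(_ isT).
  by case: i {le_in} => [|i] /=; rewrite !nth_rcons_default.
split=> [i j|i leafi].
  case/orP => /eqP E; last rewrite step_sym; rewrite -E;
    by apply: (H1 (_.+1)); rewrite E ltnW.
have [i0|ip] := posnP i; first by have := H1 0 (leq0n _); rewrite i0 /step /=; lia.
have [eq|ne] := eqVneq i.+1 n.
  have := H1 n (leqnn _); rewrite [nth 0 p n]nth_default ?sp //.
  rewrite (_ : nth 0 (0 :: p) n = nth 0 p i); last by rewrite -[in LHS]eq.
  by rewrite /step; lia.
(* An interior vertex has two distinct neighbours and is no leaf. *)
have lt1 : i.+1 < n by have := ltn_ord i; lia.
have lt2 : i.-1 < n by lia.
have : Ordinal lt1 = Ordinal lt2.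
  by apply: leafi; rewrite /path_adj /=; lia.
by move/(congr1 val) => /=; lia.
Qed.

Lemma path_adj_irr n : irreflexive (@path_adj n).
Proof. by move=> i; rewrite /path_adj; lia. Qed.

Lemma path_adj_deg2 n (s t1 t2 t3 : 'I_n) :
  path_adj s t1 -> path_adj s t2 -> path_adj s t3 ->
  [|| t1 == t2, t1 == t3 | t2 == t3].
Proof. by rewrite /path_adj -!val_eqE /=; lia. Qed.

Lemma fc_series_coxA n : fc_series (coxA n) = walk_gf 0 n.+1 0.
Proof.
apply/fpsP => k; rewrite fps_coef_walk_gf.
pose g (p : seq nat) := behead (belast 0 p).
have walkE p : p \in walks_to n.+1 0 0 k <->
    exists p', [/\ p = rcons p' 0, size p' = n, path step 0 (rcons p' 0) & sumn p' = k].
  rewrite mem_filter mem_walks; split.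
    case/lastP: p => [|p' x]; first by rewrite andbF.
    rewrite last_rcons belast_rcons size_rcons eqSS /= add0n.
    by move=> /andP[/andP[/eqP -> /eqP sk] /andP[/eqP sn pp]]; exists p'.
  move=> [p' [-> sn pp sk]].
  by rewrite last_rcons belast_rcons size_rcons /= sn sk pp !eqxx.
have gE p' x : g (rcons p' x) = p' by rewrite /g belast_rcons.
rewrite -(size_map g); apply: fc_series_coef_seq.
- exact: path_adj_irr.
- exact: path_adj_deg2.
- rewrite map_inj_in_uniq; first exact/filter_uniq/uniq_walks.
  by move=> _ _ /walkE[p [-> _ _ _]] /walkE[p' [-> _ _ _]]; rewrite !gE => ->.
move=> p; split=> [/mapP[_ /walkE[p' [-> sn pp sk]] ->]|[sn vp sk]].
  by rewrite gE; split=> //; apply/path_valid_heights.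
apply/mapP; exists (rcons p 0); rewrite ?gE //; apply/walkE.
by exists p; split=> //; apply/(path_valid_heights sn).
Qed.

(** * Cyclic Coxeter graphs and closed walks *)

Lemma cycle_adjE n (i j : 'I_n) : cycle_adj i j =
  [|| i.+1 == j, j.+1 == i, (i.+1 == n) && (j == 0 :> nat)
    | (j.+1 == n) && (i == 0 :> nat)].
Proof.
have succ (a b : 'I_n) : (a.+1 == b %[mod n]) =
    (a.+1 == b) || (a.+1 == n) && (b == 0 :> nat).
  have lta := ltn_ord a; rewrite (modn_small (ltn_ord b)).
  have [eqn|nen] := eqVneq a.+1 n; last by rewrite modn_small ?orbF //; lia.
  by rewrite {1}eqn modnn eq_sym; have := ltn_ord b; lia.
by rewrite /cycle_adj !succ; lia.
Qed.

Lemma cycle_adj_irr n : (3 <= n)%N -> irreflexive (@cycle_adj n).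
Proof. by move=> n3 i; rewrite cycle_adjE; lia. Qed.

Lemma cycle_adj_deg2 n (s t1 t2 t3 : 'I_n) :
  cycle_adj s t1 -> cycle_adj s t2 -> cycle_adj s t3 ->
  [|| t1 == t2, t1 == t3 | t2 == t3].
Proof.
rewrite !cycle_adjE -!val_eqE /=.
move: (ltn_ord t1) (ltn_ord t2) (ltn_ord t3) => lt1 lt2 lt3 /or4P H1 /or4P H2 /or4P H3.
by case: H1 => h1; case: H2 => h2; case: H3 => h3; lia.
Qed.

Lemma cycle_no_leaf n (i : 'I_n) : (3 <= n)%N -> ~ leaf (@cycle_adj n) i.
Proof.
move=> n3 leafi; have lti := ltn_ord i.
have [j ij jE] : exists2 j : 'I_n, cycle_adj i j &
    (j = i.+1 :> nat \/ i.+1 = n /\ j = 0 :> nat).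
  have [eqn|nen] := eqVneq i.+1 n.
    have lt0 : (0 < n)%N by lia.
    by exists (Ordinal lt0); [rewrite cycle_adjE /= eqn; lia | right].
  have lt1 : (i.+1 < n)%N by lia.
  by exists (Ordinal lt1); [rewrite cycle_adjE /=; lia | left].
have [j' ij' j'E] : exists2 j : 'I_n, cycle_adj i j &
    (j.+1 = i :> nat \/ i = 0 :> nat /\ j.+1 = n).
  have [eq0|ne0] := eqVneq (i : nat) 0.
    have lt0 : (n.-1 < n)%N by lia.
    by exists (Ordinal lt0); [rewrite cycle_adjE /= eq0; lia | right => /=; lia].
  have lt1 : (i.-1 < n)%N by lia.
  by exists (Ordinal lt1); [rewrite cycle_adjE /=; lia | left => /=; lia].
by have /(congr1 val) /= := leafi _ _ ij ij'; lia.
Qed.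

Lemma cycle_valid_heights n p : (3 <= n)%N -> size p = n ->
  valid_heights (@cycle_adj n) (fun i => nth 0 p i) <-> cycle step p.
Proof.
move=> n3; case: p => [|x p] sp; first by move: n3; rewrite -sp.
have nthE i : (i < n)%N -> nth 0 (x :: rcons p x) i = nth 0 (x :: p) i.
  by move=> lt_in; rewrite -rcons_cons nth_rcons sp lt_in.
have nthSE i : (i < n)%N ->
    nth 0 (rcons p x) i = nth 0 (x :: p) (if i.+1 == n then 0 else i.+1).
  move=> lt_in; rewrite nth_rcons; move: sp => /= [sp].
  have [eq|ne] := eqVneq i.+1 n; last by rewrite (_ : i < size p)%N //; lia.
  have -> : i = size p by lia.
  by rewrite ltnn eqxx.
split=> [[hstep _]|].
  apply/(pathP 0) => i; rewrite size_rcons -[(size p).+1]/(size (x :: p)) sp => lt_in.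
  rewrite nthE // nthSE //.
  have lt1 : ((if i.+1 == n then 0 else i.+1) < n)%N by case: eqP; lia.
  apply: (hstep (Ordinal lt_in) (Ordinal lt1)); rewrite cycle_adjE /=.
  by have [_|_] := eqVneq i.+1 n; rewrite ?eqxx ?orbT.
rewrite /= => /(pathP 0) H.
have H1 i : (i < n)%N ->
    step (nth 0 (x :: p) i) (nth 0 (x :: p) (if i.+1 == n then 0 else i.+1)).
  move=> lt_in; rewrite -nthE // -nthSE //; apply: H.
  by rewrite size_rcons -[(size p).+1]/(size (x :: p)) sp.
split=> [i j|i /cycle_no_leaf -/(_ n3)//].
have lti := ltn_ord i; have ltj := ltn_ord j.
rewrite cycle_adjE => /or4P[/eqP E|/eqP E|/andP[/eqP E /eqP E0]|/andP[/eqP E /eqP E0]].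
- by have := H1 i lti; rewrite E ltn_eqF.
- by have := H1 j ltj; rewrite E ltn_eqF // step_sym.
- by have := H1 i lti; rewrite E eqxx E0.
- by have := H1 j ltj; rewrite E eqxx E0 step_sym.
Qed.

Lemma fc_series_coef_cox_affA n k : (3 <= n)%N ->
  fps_coef (fc_series (cox_affA n)) k =
  (\sum_(i < k.+1) fps_coef (walk_gf i n i) k)%R.
Proof.
move=> n3.
(* [belast i p] lists the heights around the cycle from the starting one, without its repetition at
   the end. The starting height is one of the summands of [k], hence at most [k]. *)
pose L := [seq belast i p | i <- iota 0 k.+1, p <- walks_to n i i k].
have walkE i p : p \in walks_to n i i k <->
    exists p', [/\ p = rcons p' i, size (i :: p') = n, cycle step (i :: p')
                  & sumn (i :: p') = k].
  rewrite mem_filter mem_walks; split.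
    case/lastP: p => [|p' x]; first by rewrite /=; lia.
    rewrite last_rcons belast_rcons size_rcons => /andP[/andP[/eqP -> /eqP sk]].
    by move=> /andP[/eqP sn pp]; exists p'.
  move=> [p' [-> sn pp sk]].
  by rewrite last_rcons belast_rcons size_rcons -[(size p').+1]/(size (i :: p'))
    sn sk !eqxx.
have -> : (\sum_(i < k.+1) fps_coef (walk_gf i n i) k)%R = Posz (size L).
  rewrite size_allpairs_dep sumnE big_map -natz natr_sum -[iota _ _]/(index_iota 0 k.+1).
  by rewrite big_mkord; apply: eq_bigr => i _; rewrite fps_coef_walk_gf natz.
apply: fc_series_coef_seq.
- exact: cycle_adj_irr.
- exact: cycle_adj_deg2.
- apply: allpairs_uniq_dep => [|i _|]; first exact: iota_uniq.
    exact/filter_uniq/uniq_walks.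
  move=> x y /allpairsPdep[i [p [_ /walkE[p1 [-> _ _ _]] ->]]].
  move=> /allpairsPdep[j [r [_ /walkE[r1 [-> _ _ _]] ->]]] /=.
  by rewrite !belast_rcons => -[-> ->].
move=> p; split.
  move=> /allpairsPdep[i [r [_ /walkE[p' [-> sn pp sk]] ->]]].
  by rewrite belast_rcons; split=> //; apply/cycle_valid_heights.
move=> [sn vp sk]; case: p sn vp sk => [|i p] sn vp sk; first by rewrite -sn in n3.
apply/allpairsPdep; exists i, (rcons p i); rewrite belast_rcons; split=> //.
  by rewrite mem_iota /= add0n ltnS -sk leq_addr.
by apply/walkE; exists p; split=> //; apply/(cycle_valid_heights n3 sn).
Qed.

Local Open Scope ring_scope.

Theorem theorem1p2 :
  A_series = fps_scale (- q) J / J /\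
  (forall n : nat, (3 <= n)%N ->
     fc_series (cox_affA n) = fps_coef (- fpsX * (fps_deriv J / J)) n).
Proof.
split=> [|n n3].
  by rewrite -open_walk_series; apply/fpsP => n; apply: fc_series_coxA.
apply/fpsP => k; rewrite closed_walk_series ?fc_series_coef_cox_affA //.
exact: ltnW (ltnW n3).
Qed.
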